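(* Let $\{P_n(\cdot;t)\}_{n\ge 0}$ be the monic matrix valued orthogonal polynomials with respect to $W(x;t)\,d\mu(x)$, where $W(x;t)=e^{-xt\Lambda}W(x)$, and let $B_n(t)$, $C_n(t)$ be the coefficients in the three-term recurrence relation $$xP_n(x;t)=P_{n+1}(x;t)+B_n(t)P_n(x;t)+C_n(t)P_{n-1}(x;t).$$ Then, for all $t\in I$ (the dot denoting the derivative with respect to $t$), $$\dot C_n(t)=\Lambda\bigl(C_n(t)B_{n-1}(t)-B_n(t)C_n(t)\bigr)\quad (n\ge 1),\qquad \dot B_n(t)=\Lambda\bigl(C_n(t)-C_{n+1}(t)\bigr)\quad (n\ge 0).$$
   Context: $N\ge1$ is an integer, $\mu$ is a positive Borel measure on $\mathbb{R}$ whose support $S$ is not a finite set, $W$ is a (measurable) complex $N\times N$ matrix valued function on $S$, $\Lambda$ is a constant complex $N\times N$ matrix, and $I\subset\mathbb{R}$ is an open interval containing $0$. Put $W(x;t)=e^{-xt\Lambda}W(x)$ for $t\in I$. Standing assumptions: $W(x;t)$ is a (Hermitian) positive definite matrix for all $x\in S$, $t\in I$, and all moments $\int x^k W(x;t)\,d\mu(x)$, $k\in\mathbb{N}$, exist for all $t\in I$. (This forces $\Lambda W(x;t)=W(x;t)\Lambda^\ast$, where $^\ast$ is the conjugate transpose.) The monic orthogonal polynomials $P_n(x;t)$ are the unique polynomials in $x$ with $N\times N$ matrix coefficients, of degree $n$ with leading coefficient the identity $I$, such that $\int_{\mathbb{R}}P_n(x;t)\,W(x;t)\,P_m(x;t)^\ast\,d\mu(x)=\delta_{n,m}H_n(t)$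 with $H_n(t)$ positive definite. Convention: $P_{-1}=0$ and $C_0(t)=0$.
   Formalization: If μ has an atom at 0, the relation ΛW(0)=W(0)Λ* is assumed: the standing assumptions force ΛW(x;t)=W(x;t)Λ* only for x≠0, and the claim fails e.g. for Λ=diag(1,2), μ=Lebesgue+δ_0, W(x)=e^{-x²}Id for x≠0, W(0) positive definite non-diagonal. *)

(* Defs.v *)
From mathcomp Require Import all_boot all_order all_algebra.
From mathcomp Require Import all_classical all_reals all_analysis.
From mathcomp Require Import complex.

Set Implicit Arguments.
Unset Strict Implicit.
Unset Printing Implicit Defensive.

Import Order.TTheory GRing.Theory Num.Theory.
Import numFieldNormedType.Exports.

Local Open Scope classical_set_scope.
Local Open Scope ring_scope.
Local Open Scope complex_scope.
Local Open Scope sesquilinear_scope.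

(* Analytic notions for matrices over R[i] are taken entrywise, on real and
   imaginary parts. *)

Definition mx_measurable_fun (R : realType) (m n : nat) (D : set R)
    (F : R -> 'M[R[i]]_(m, n)) : Prop :=
  forall i j,
    measurable_fun (D : set (measurableTypeR R))
      (fun x => complex.Re (F x i j) : measurableTypeR R) /\
    measurable_fun (D : set (measurableTypeR R))
      (fun x => complex.Im (F x i j) : measurableTypeR R).

Definition mx_integrable (R : realType) (m n : nat)
    (mu : {measure set (measurableTypeR R) -> \bar R}) (D : set R)
    (F : R -> 'M[R[i]]_(m, n)) : Prop :=
  forall i j,
    mu.-integrable D (fun x => (complex.Re (F x i j))%:E) /\
    mu.-integrable D (fun x => (complex.Im (F x i j))%:E).

Definition mx_integral (R : realType) (m n : nat)
    (mu : {measure set (measurableTypeR R) -> \bar R}) (D : set R)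
    (F : R -> 'M[R[i]]_(m, n)) : 'M[R[i]]_(m, n) :=
  \matrix_(i, j)
    ((\int[mu]_(x in D) complex.Re (F x i j)) +i*
     (\int[mu]_(x in D) complex.Im (F x i j))).

(* The real variable function F is differentiable at t with derivative F'. *)
Definition mx_is_derive (R : realType) (m n : nat) (t : R)
    (F : R -> 'M[R[i]]_(m, n)) (F' : 'M[R[i]]_(m, n)) : Prop :=
  forall i j,
    is_derive t 1 (fun s => complex.Re (F s i j)) (complex.Re (F' i j)) /\
    is_derive t 1 (fun s => complex.Im (F s i j)) (complex.Im (F' i j)).

(* The sum of the (everywhere convergent) exponential series. *)
Definition expmx (R : realType) (N : nat) (A : 'M[R[i]]_N.+1) :
    'M[R[i]]_N.+1 :=
  let S n := \sum_(k < n) (k`!%:R)^-1 *: A ^+ k in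
  \matrix_(i, j)
    (limn (fun n => complex.Re (S n i j)) +i*
     limn (fun n => complex.Im (S n i j))).

Definition posdefmx (R : realType) (N : nat) (A : 'M[R[i]]_N.+1) : Prop :=
  A \is hermsymmx /\
  forall v : 'rV[R[i]]_N.+1, v != 0 -> 0 < (v *m A *m v^t*) 0 0.

Definition msupport (R : realType)
    (mu : {measure set (measurableTypeR R) -> \bar R}) : set R :=
  [set x | forall U : set R, open U -> U x -> (0 < mu U)%E].

(* W(x;t) = e^{-xt Lambda} W(x) *)
Definition toda_weight (R : realType) (N : nat) (Lambda : 'M[R[i]]_N.+1)
    (W : R -> 'M[R[i]]_N.+1) (x t : R) : 'M[R[i]]_N.+1 :=
  expmx ((- (x * t))%:C *: Lambda) *m W x.

(* The value at the real point x of a polynomial with matrix coefficients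
   (the scalar matrix x is central). *)
Definition evalmx (R : realType) (N : nat) (p : {poly 'M[R[i]]_N.+1}) (x : R) :
    'M[R[i]]_N.+1 :=
  p.[(x%:C)%:M].

(* The weight is a function on the support of mu; the complement of the
   support is mu-null, so these are the integrals over the whole line. *)
Definition monic_orthopoly (R : realType) (N : nat)
    (mu : {measure set (measurableTypeR R) -> \bar R})
    (W : R -> 'M[R[i]]_N.+1) (P : nat -> {poly 'M[R[i]]_N.+1}) : Prop :=
  (forall n, size (P n) = n.+1 /\ P n \is monic) /\
  exists H : nat -> 'M[R[i]]_N.+1,
    (forall n, posdefmx (H n)) /\
    forall n m,
      mx_integral mu (msupport mu)
        (fun x => evalmx (P n) x *m W x *m (evalmx (P m) x)^t*) =
      if n == m then H n else 0.

(* Main.v *)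
Require Import Defs.
From mathcomp Require Import all_boot all_order all_algebra.
From mathcomp Require Import all_classical all_reals all_analysis.
From mathcomp Require Import perm complex ring lra.

Set Implicit Arguments.
Unset Strict Implicit.
Unset Printing Implicit Defensive.

Import Order.TTheory GRing.Theory Num.Theory.
Import numFieldNormedType.Exports.

Local Open Scope classical_set_scope.
Local Open Scope ring_scope.
Local Open Scope complex_scope.
Local Open Scope sesquilinear_scope.

(** Put [V x t := e^(-x t Lambda) W x].

    Differentiating in [t] gives [V' = - x Lambda V], and since [V x t] is Hermitian
    on an open interval of [t], so is [x Lambda V]: hence
    [x Lambda V = x V Lambda^*], where [x] cancels off [0]; at an atom at [0] the
    relation [Lambda V = V Lambda^*] is assumed.  Integrating, the moments [M_k] satisfy
    [Lambda M_k = M_k Lambda^*] and [M_k' = - Lambda M_(k+1)]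
    (lemmas [moment_intertwine], [moment_derive]).  Differentiation under the
    integral needs a bound that is uniform for [t] near a given point.  It comes from
    positivity: [t |-> v V v^*] is nonnegative with second derivative
    [(x v Lambda) V (x v Lambda)^* >= 0], so it is convex, and on [[a, b]] it is at
    most the sum of its values at [a] and [b].  As a positive matrix is bounded by
    its trace, [|x|^(k+1)] times the sum of the traces of [V x a] and [V x b]
    dominates, up to a constant.

    The rest is algebra.  The inner product is the bilinear pairing
    [<F, G> = \sum_(i, j) F_i M_(i+j) G_j] of [F = P_n] with [G], the polynomial
    whose coefficients are the adjoints of those of [P_m].
    Writing [H_n] for [<P_n, P_n>], the recurrence gives
    [B_n H_n = <x P_n, P_n>] and [C_n H_(n-1) = <x P_n, P_(n-1)> = H_n].
    By induction along these formulas, everything is differentiable in [t] and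
    [Lambda] commutes with [P_n], [B_n] and [C_n] (lemma [orthogonal_comm]).
    A derivative [P_n'] has degree less than [n], because [P_n] is monic.
    Therefore differentiating [<P_n, P_n> = H_n] leaves
    [H_n' = - Lambda <x P_n, P_n> = - Lambda B_n H_n], and the equation for [C_n]
    follows from [C_n H_(n-1) = H_n].  Let [p_n] be the coefficient of degree [n-1]
    in [P_n].  Differentiating [<P_n, P_(n-1)> = 0] leaves
    [p_n' H_(n-1) = Lambda <x P_n, P_(n-1)> = Lambda C_n H_(n-1)], so
    [p_n' = Lambda C_n], and the equation for [B_n] follows from
    [B_n = p_n - p_(n+1)]. *)

(** * Differential calculus of complex matrix functions *)

Section ComplexDerivatives.
Variable R : realType.
Implicit Types (f g : R -> R[i]) (t : R).

Lemma ReM (x y : R[i]) :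
  complex.Re (x * y) = complex.Re x * complex.Re y - complex.Im x * complex.Im y.
Proof. by case: x y => [a b] [c d]. Qed.

Lemma ImM (x y : R[i]) :
  complex.Im (x * y) = complex.Re x * complex.Im y + complex.Im x * complex.Re y.
Proof. by case: x y => [a b] [c d]. Qed.

Lemma ReD (x y : R[i]) : complex.Re (x + y) = complex.Re x + complex.Re y.
Proof. by case: x y => [a b] [c d]. Qed.

Lemma ImD (x y : R[i]) : complex.Im (x + y) = complex.Im x + complex.Im y.
Proof. by case: x y => [a b] [c d]. Qed.

Lemma complexP (x y : R[i]) :
  complex.Re x = complex.Re y -> complex.Im x = complex.Im y -> x = y.
Proof. by case: x y => [a b] [c d] /= -> ->. Qed.

Lemma r_is_deriveD t (f g : R -> R) a b :
  is_derive t 1 f a -> is_derive t 1 g b ->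
  is_derive t 1 (fun s => f s + g s) (a + b).
Proof. exact: (@is_deriveD _ _ _ f g). Qed.

Lemma r_is_derive_eq t (f : R -> R) a b :
  is_derive t 1 f a -> a = b -> is_derive t 1 f b.
Proof. by move=> ? <-. Qed.

Lemma r_is_deriveN t (f : R -> R) a :
  is_derive t 1 f a -> is_derive t 1 (fun s => - f s) (- a).
Proof. exact: (@is_deriveN _ _ _ f). Qed.

Lemma r_is_deriveM t (f g : R -> R) a b :
  is_derive t 1 f a -> is_derive t 1 g b ->
  is_derive t 1 (fun s => f s * g s) (a * g t + f t * b).
Proof.
move=> fa gb; rewrite addrC [X in _ + X]mulrC.
exact: (@is_deriveM _ _ f g).
Qed.

Definition c_is_derive t f (f' : R[i]) : Prop :=
  is_derive t 1 (fun s => complex.Re (f s)) (complex.Re f') /\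
  is_derive t 1 (fun s => complex.Im (f s)) (complex.Im f').

Lemma c_is_derive_unique t f a b :
  c_is_derive t f a -> c_is_derive t f b -> a = b.
Proof.
move=> [fr fi] [gr gi]; apply: complexP.
- by rewrite -(@derive_val _ _ _ _ _ _ _ fr) -(@derive_val _ _ _ _ _ _ _ gr).
- by rewrite -(@derive_val _ _ _ _ _ _ _ fi) -(@derive_val _ _ _ _ _ _ _ gi).
Qed.

Lemma c_is_derive_near t f g a :
  (\near t, f t = g t) -> c_is_derive t f a -> c_is_derive t g a.
Proof.
move=> fg [fr fi]; split.
- by apply: near_eq_is_derive fr; apply: filterS fg => s ->.
- by apply: near_eq_is_derive fi; apply: filterS fg => s ->.
Qed.

Lemma c_is_derive_cst t (a : R[i]) : c_is_derive t (fun=> a) 0.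
Proof. by split; exact: is_derive_cst. Qed.

Lemma c_is_deriveD t f g a b : c_is_derive t f a -> c_is_derive t g b ->
  c_is_derive t (fun s => f s + g s) (a + b).
Proof.
move=> [fr fi] [gr gi]; split.
- under eq_fun do rewrite ReD.
  rewrite ReD; exact: r_is_deriveD.
- under eq_fun do rewrite ImD.
  rewrite ImD; exact: r_is_deriveD.
Qed.

Lemma c_is_deriveM t f g a b : c_is_derive t f a -> c_is_derive t g b ->
  c_is_derive t (fun s => f s * g s) (a * g t + f t * b).
Proof.
move=> [fr fi] [gr gi]; split.
- under eq_fun do rewrite ReM.
  apply: (r_is_derive_eq (r_is_deriveD (r_is_deriveM fr gr)
    (r_is_deriveN (r_is_deriveM fi gi)))).
  rewrite ReD !ReM; ring.
- under eq_fun do rewrite ImM.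
  apply: (r_is_derive_eq (r_is_deriveD (r_is_deriveM fr gi) (r_is_deriveM fi gr))).
  rewrite ImD !ImM; ring.
Qed.

Lemma c_is_derive_sum t (J : Type) (r : seq J) (Q : pred J)
    (f : J -> R -> R[i]) (a : J -> R[i]) :
  (forall j, c_is_derive t (f j) (a j)) ->
  c_is_derive t (fun s => \sum_(j <- r | Q j) f j s) (\sum_(j <- r | Q j) a j).
Proof.
move=> fa; elim: r => [|j r IH].
  rewrite big_nil; under eq_fun do rewrite big_nil; exact: c_is_derive_cst.
rewrite big_cons; under eq_fun do rewrite big_cons.
by case: (Q j) => //; apply: c_is_deriveD.
Qed.

Lemma c_derivable_prod t (J : Type) (r : seq J) (f : J -> R -> R[i]) :
  (forall j, exists a, c_is_derive t (f j) a) ->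
  exists a, c_is_derive t (fun s => \prod_(j <- r) f j s) a.
Proof.
move=> fa; elim: r => [|j r [b IH]].
  exists 0; under eq_fun do rewrite big_nil; exact: c_is_derive_cst.
have [a fja] := fa j.
eexists; under eq_fun do rewrite big_cons.
exact: c_is_deriveM fja IH.
Qed.

Lemma c_is_derive_conj t f a : c_is_derive t f a ->
  c_is_derive t (fun s => (f s)^*) (a^*).
Proof.
move=> [fr fi]; split.
- by rewrite (_ : (fun s => _) = (fun s => complex.Re (f s)));
    [case: (a) fr|apply/funext => s; case: (f s)].
- rewrite (_ : (fun s => _) = (fun s => - complex.Im (f s))).
    by rewrite (_ : complex.Im _ = - complex.Im a); [exact: r_is_deriveN|case: (a)].
  by apply/funext => s; rewrite [RHS]/=; case: (f s).
Qed.

Lemma c_derivableV t f a : f t != 0 -> c_is_derive t f a ->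
  exists b, c_is_derive t (fun s => (f s)^-1) b.
Proof.
move=> ft0 [fr fi].
(* The inverse of [z] is its conjugate divided by its squared modulus. *)
pose n2 s := complex.Re (f s) * complex.Re (f s) + complex.Im (f s) * complex.Im (f s).
have n2t : n2 t != 0.
  apply: contraNneq ft0; rewrite /n2 -!expr2 => /eqP.
  by rewrite paddr_eq0 ?sqr_ge0// !sqrf_eq0 eq_complex.
have dn2 : derivable n2 t 1.
  by apply: derivableD; apply: derivableM; apply: ex_derive.
have /derivableP := derivableV n2t dn2; set d := 'D__ _ _ => dV.
exists ((complex.Re a * (n2 t)^-1 + complex.Re (f t) * d) +i*
  - (complex.Im a * (n2 t)^-1 + complex.Im (f t) * d)); split.
- rewrite (_ : (fun s => _) =
      (fun s => complex.Re (f s) * (n2 s)^-1)); last first.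
    by apply/funext => s; rewrite /n2 [RHS]/=; case: (f s).
  apply: (r_is_derive_eq (r_is_deriveM fr dV)).
  by rewrite [RHS]/=; ring.
- rewrite (_ : (fun s => _) =
      (fun s => - (complex.Im (f s) * (n2 s)^-1))); last first.
    apply/funext => s; rewrite /n2 [RHS]/=; case: (f s) => x y /=.
    by [].
  apply: (r_is_derive_eq (r_is_deriveN (r_is_deriveM fi dV))).
  by rewrite [RHS]/=; ring.
Qed.

End ComplexDerivatives.

Section MatrixDerivatives.
Variable R : realType.
Implicit Types t : R.

Lemma mx_is_deriveP m n t (F : R -> 'M[R[i]]_(m, n)) A :
  mx_is_derive t F A <-> forall i j, c_is_derive t (fun s => F s i j) (A i j).
Proof. by []. Qed.

Lemma mx_is_derive_unique m n t (F : R -> 'M[R[i]]_(m, n)) A B :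
  mx_is_derive t F A -> mx_is_derive t F B -> A = B.
Proof.
by move=> FA FB; apply/matrixP => i j; exact: c_is_derive_unique (FA i j) (FB i j).
Qed.

Lemma mx_is_derive_near m n t (F G : R -> 'M[R[i]]_(m, n)) A :
  (\near t, F t = G t) -> mx_is_derive t F A -> mx_is_derive t G A.
Proof.
move=> FG FA; apply/mx_is_deriveP => i j.
by apply: c_is_derive_near (FA i j); apply: filterS FG => s ->.
Qed.

Lemma mx_is_derive_cst m n t (A : 'M[R[i]]_(m, n)) : mx_is_derive t (fun=> A) 0.
Proof. by move=> i j; rewrite mxE; exact: c_is_derive_cst. Qed.

Lemma mx_is_deriveD m n t (F G : R -> 'M[R[i]]_(m, n)) A B :
  mx_is_derive t F A -> mx_is_derive t G B ->
  mx_is_derive t (fun s => F s + G s) (A + B).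
Proof.
move=> FA GB; apply/mx_is_deriveP => i j; rewrite mxE.
under eq_fun do rewrite mxE.
exact: c_is_deriveD (FA i j) (GB i j).
Qed.

Lemma mx_is_deriveM m n p t (F : R -> 'M[R[i]]_(m, n)) (G : R -> 'M[R[i]]_(n, p)) A B :
  mx_is_derive t F A -> mx_is_derive t G B ->
  mx_is_derive t (fun s => F s *m G s) (A *m G t + F t *m B).
Proof.
move=> FA GB; apply/mx_is_deriveP => i j; rewrite !mxE -big_split /=.
under eq_fun do rewrite mxE.
by apply: c_is_derive_sum => k; exact: c_is_deriveM (FA i k) (GB k j).
Qed.

Lemma mx_is_deriveMl m n p t (A : 'M[R[i]]_(m, n)) (F : R -> 'M[R[i]]_(n, p)) B :
  mx_is_derive t F B -> mx_is_derive t (fun s => A *m F s) (A *m B).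
Proof.
move=> FB; rewrite -[_ *m _]add0r -(mul0mx _ (F t)).
exact: mx_is_deriveM (mx_is_derive_cst _ _) FB.
Qed.

Lemma mx_is_deriveMr m n p t (F : R -> 'M[R[i]]_(m, n)) (A : 'M[R[i]]_(n, p)) B :
  mx_is_derive t F B -> mx_is_derive t (fun s => F s *m A) (B *m A).
Proof.
move=> FB; rewrite -[_ *m _]addr0 -(mulmx0 _ (F t)).
exact: mx_is_deriveM FB (mx_is_derive_cst _ _).
Qed.

Lemma mx_is_deriveN m n t (F : R -> 'M[R[i]]_(m, n)) A :
  mx_is_derive t F A -> mx_is_derive t (fun s => - F s) (- A).
Proof.
have N1 (B : 'M[R[i]]_(m, n)) : - B = (-1)%:M *m B by rewrite mul_scalar_mx scaleN1r.
move=> FA; rewrite N1; under eq_fun do rewrite N1.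
exact: mx_is_deriveMl.
Qed.

Lemma mx_is_deriveB m n t (F G : R -> 'M[R[i]]_(m, n)) A B :
  mx_is_derive t F A -> mx_is_derive t G B ->
  mx_is_derive t (fun s => F s - G s) (A - B).
Proof. by move=> FA GB; exact: mx_is_deriveD FA (mx_is_deriveN GB). Qed.

Lemma mx_is_derive_sum m n t (J : Type) (r : seq J) (Q : pred J)
    (F : J -> R -> 'M[R[i]]_(m, n)) (A : J -> 'M[R[i]]_(m, n)) :
  (forall j, mx_is_derive t (F j) (A j)) ->
  mx_is_derive t (fun s => \sum_(j <- r | Q j) F j s) (\sum_(j <- r | Q j) A j).
Proof.
move=> FA; apply/mx_is_deriveP => i j; rewrite summxE.
by under eq_fun do rewrite summxE; apply: c_is_derive_sum => k; exact: FA.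
Qed.

Lemma mx_is_derive_adj m n t (F : R -> 'M[R[i]]_(m, n)) A :
  mx_is_derive t F A -> mx_is_derive t (fun s => (F s)^t*) (A^t*).
Proof.
move=> FA; apply/mx_is_deriveP => i j; rewrite !mxE.
by under eq_fun do rewrite !mxE; exact: c_is_derive_conj (FA j i).
Qed.

Definition mx_derivable m n t (F : R -> 'M[R[i]]_(m, n)) :=
  exists A, mx_is_derive t F A.

Lemma c_derivable_det n t (F : R -> 'M[R[i]]_n) :
  (forall i j, exists a, c_is_derive t (fun s => F s i j) a) ->
  exists a, c_is_derive t (fun s => \det (F s)) a.
Proof.
move=> dF; rewrite /determinant.
have dprod (s : {perm 'I_n}) : {a | c_is_derive t
    (fun u => (-1) ^+ s * \prod_i F u i (s i)) a}.
  apply: cid.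
  have [|a da] := @c_derivable_prod R t _ (index_enum 'I_n) (fun i u => F u i (s i)).
    by move=> i; exact: dF.
  by eexists; exact: c_is_deriveM (c_is_derive_cst _ _) da.
exists (\sum_(s : {perm 'I_n}) sval (dprod s)).
by apply: c_is_derive_sum => s; exact: (svalP (dprod s)).
Qed.

(** Cramer's rule makes the entries of the inverse rational functions of the
    entries of the matrix. *)
Lemma mx_derivableV n t (F : R -> 'M[R[i]]_n) :
  (\near t, F t \in unitmx) -> mx_derivable t F -> mx_derivable t (fun s => invmx (F s)).
Proof.
move=> uF [A FA].
have [|d dd] := @c_derivable_det n t F; first by move=> i j; exists (A i j); exact: FA.
have [|e de] := @c_derivableV R t _ d _ dd.
  by have := nbhs_singleton uF; rewrite unitmxE unitfE.
have dadj i j : {a | c_is_derive t (fun s => \adj (F s) i j) a}.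
  apply: cid; rewrite /adjugate.
  have [|a da] := @c_derivable_det n.-1 t (fun s => row' j (col' i (F s))).
    move=> k l; eexists; under eq_fun do rewrite !mxE; exact: FA.
  eexists; under eq_fun do rewrite mxE; exact: c_is_deriveM (c_is_derive_cst _ _) da.
exists (\matrix_(i, j)
  (e * \adj (F t) i j + (\det (F t))^-1 * sval (dadj i j))).
apply/mx_is_deriveP => i j; rewrite mxE.
apply: (@c_is_derive_near _ _ (fun s => (\det (F s))^-1 * \adj (F s) i j)).
  by apply: filterS uF => s us; rewrite /invmx us !mxE.
exact: c_is_deriveM de (svalP (dadj i j)).
Qed.

End MatrixDerivatives.

(** * The matrix exponential *)

Section MatrixExponential.
Variables (R : realType) (N : nat).
Implicit Types (A : 'M[R[i]]_N.+1) (s : R).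

Definition c_cvg (u : nat -> R[i]) (l : R[i]) : Prop :=
  (complex.Re (u n) @[n --> \oo] --> complex.Re l) /\
  (complex.Im (u n) @[n --> \oo] --> complex.Im l).

Lemma c_cvg_unique u l l' : c_cvg u l -> c_cvg u l' -> l = l'.
Proof.
move=> [ur ui] [vr vi]; apply: complexP.
- by rewrite -(cvg_lim _ ur)// -(cvg_lim _ vr).
- by rewrite -(cvg_lim _ ui)// -(cvg_lim _ vi).
Qed.

Lemma c_cvgMl (a : R[i]) u l : c_cvg u l -> c_cvg (fun n => a * u n) (a * l).
Proof.
move=> [ur ui]; split.
- under eq_fun do rewrite ReM.
  by rewrite ReM; apply: cvgB; apply: cvgMr.
- under eq_fun do rewrite ImM.
  by rewrite ImM; apply: cvgD; apply: cvgMr.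
Qed.

Lemma c_cvg_sum (J : Type) (r : seq J) (u : J -> nat -> R[i]) (l : J -> R[i]) :
  (forall j, c_cvg (u j) (l j)) ->
  c_cvg (fun n => \sum_(j <- r) u j n) (\sum_(j <- r) l j).
Proof.
move=> ul; elim: r => [|j r [IHr IHi]].
  by rewrite big_nil; under eq_fun do rewrite big_nil; split; exact: cvg_cst.
rewrite big_cons; under eq_fun do rewrite big_cons.
have [ur ui] := ul j; split.
- by under eq_fun do rewrite ReD; rewrite ReD; exact: cvgD.
- by under eq_fun do rewrite ImD; rewrite ImD; exact: cvgD.
Qed.

(** The coefficient of [s ^+ k] in the [part] of the [(i, j)] entry of
    [A ^+ m * e^(s A)].  Termwise differentiation raises [m] by one, so the
    successive formal derivatives of the series all have this form. *)
Definition exp_diff_coef (part : R[i] -> R) A m i j (k : nat) : R :=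
  (k`!%:R)^-1 * part ((A ^+ (k + m)) i j).

Lemma pseries_diffs_exp_coef part A m i j :
  pseries_diffs (exp_diff_coef part A m i j) = exp_diff_coef part A m.+1 i j.
Proof.
apply/funext => k; rewrite /pseries_diffs /exp_diff_coef factS natrM invfM addSnnS.
by rewrite -mulrA mulVKf// pnatr_eq0.
Qed.

(** On [R[i]] this norm is equivalent to the modulus, takes real values and is
    submultiplicative. *)
Definition cnorm1 (z : R[i]) : R := `|complex.Re z| + `|complex.Im z|.

Lemma cnorm1D z w : cnorm1 (z + w) <= cnorm1 z + cnorm1 w.
Proof. by rewrite /cnorm1 ReD ImD addrACA lerD// ler_normD. Qed.

Lemma cnorm1M z w : cnorm1 (z * w) <= cnorm1 z * cnorm1 w.
Proof.
rewrite /cnorm1 ReM ImM mulrDl !mulrDr -!normrM.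
apply: le_trans (lerD (ler_normB _ _) (ler_normD _ _)) _.
by rewrite le_eqVlt; apply/orP; left; apply/eqP; ring.
Qed.

Lemma cnorm1_sum n (f : 'I_n -> R[i]) : cnorm1 (\sum_k f k) <= \sum_k cnorm1 (f k).
Proof.
apply: (big_ind2 (fun z x => cnorm1 z <= x)) => // [|z x w y zx wy].
  by rewrite /cnorm1 normr0 addr0.
by apply: le_trans (cnorm1D _ _) _; exact: lerD.
Qed.

Let bnd A : R := N.+1%:R * (\sum_i \sum_j cnorm1 (A i j)).

Let cnorm1_exp A k i j : cnorm1 ((A ^+ k) i j) <= bnd A ^+ k.
Proof.
have cnorm1_ge0 z : 0 <= cnorm1 z by rewrite addr_ge0.
elim: k i j => [|k IH] i j.
  rewrite !expr0 mxE; case: (i == j) => /=; rewrite /cnorm1 /=.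
    by rewrite normr1 normr0 addr0.
  by rewrite normr0 addr0.
rewrite exprS -mulmxE mxE; apply: le_trans (cnorm1_sum _) _.
rewrite exprS {1}/bnd -mulrA mulr_natl -[X in _ *+ X]card_ord -sumr_const.
apply: ler_sum => l _; apply: le_trans (cnorm1M _ _) _; apply: ler_pM => //.
rewrite (bigD1 i)//= (bigD1 l)//= -addrA lerDl addr_ge0//.
  by apply: sumr_ge0 => *.
by apply: sumr_ge0 => *; apply: sumr_ge0.
Qed.

Lemma is_cvg_exp_coef part A m i j K : (forall z, `|part z| <= cnorm1 z) ->
  cvgn (pseries (exp_diff_coef part A m i j) K).
Proof.
move=> partE; apply: normed_cvg => /=.
have b0 : 0 <= bnd A.
  by rewrite mulr_ge0// sumr_ge0// => k _; rewrite sumr_ge0// => l _; rewrite addr_ge0.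
apply: (@series_le_cvg _ _ (bnd A ^+ m *: exp_coeff (bnd A * `|K|))) => [n|n|n|].
- exact: normr_ge0.
- by rewrite mulr_ge0 ?exprn_ge0// exp_coeff_ge0// mulr_ge0.
- have -> : (bnd A ^+ m *: exp_coeff (bnd A * `|K|)) n =
      (n`!%:R)^-1 * bnd A ^+ (n + m) * `|K| ^+ n.
    rewrite exprD; transitivity (bnd A ^+ m * ((bnd A * `|K|) ^+ n / n`!%:R)) => //.
    rewrite [(_ * `|K|) ^+ n]exprMn; move: (bnd A) => b; ring.
  rewrite /exp_diff_coef /= !normrM normfV normr_nat normrX.
  rewrite ler_wpM2r ?exprn_ge0// ler_wpM2l ?invr_ge0//.
  exact: le_trans (partE _) (cnorm1_exp _ _ _ _).
- by apply: is_cvg_seriesZ; exact: is_cvg_series_exp_coeff.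
Qed.

Lemma is_cvg_exp_coef_ReIm A m i j K :
  cvgn (pseries (exp_diff_coef (@complex.Re R) A m i j) K) /\
  cvgn (pseries (exp_diff_coef (@complex.Im R) A m i j) K).
Proof. by split; apply: is_cvg_exp_coef => z; rewrite /cnorm1 ?lerDl ?lerDr. Qed.

Let is_derive_exp_coef part A m i j s : (forall z, `|part z| <= cnorm1 z) ->
  is_derive s 1 (fun u => limn (pseries (exp_diff_coef part A m i j) u))
    (limn (pseries (exp_diff_coef part A m.+1 i j) s)).
Proof.
move=> partE; rewrite -pseries_diffs_exp_coef.
apply: (@pseries_snd_diffs _ _ (`|s| + 1)); rewrite ?pseries_diffs_exp_coef;
  try exact: is_cvg_exp_coef.
by rewrite [X in _ < X]ger0_norm ?addr_ge0// ltrDl.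
Qed.

(** Partial sums of the series of [A ^+ m * e^(s A)]. *)
Definition exp_diff_psum A m s n : 'M[R[i]]_N.+1 :=
  \sum_(k < n) ((k`!%:R)^-1 * s ^+ k)%:C *: A ^+ (k + m).

Lemma exp_psum_entry A m s n i j :
  complex.Re (exp_diff_psum A m s n i j) =
    pseries (exp_diff_coef (@complex.Re R) A m i j) s n /\
  complex.Im (exp_diff_psum A m s n i j) =
    pseries (exp_diff_coef (@complex.Im R) A m i j) s n.
Proof.
rewrite /exp_diff_psum /pseries /series /= !big_mkord summxE.
by split; rewrite raddf_sum; apply: eq_bigr => k _;
  rewrite mxE /= ?ReM ?ImM /exp_diff_coef /=; ring.
Qed.

Definition exp_diff A m s : 'M[R[i]]_N.+1 :=
  \matrix_(i, j) (limn (pseries (exp_diff_coef (@complex.Re R) A m i j) s) +i*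
                   limn (pseries (exp_diff_coef (@complex.Im R) A m i j) s)).

Lemma cvg_exp_psum A m s i j : c_cvg (fun n => exp_diff_psum A m s n i j) (exp_diff A m s i j).
Proof.
rewrite mxE; have [cr ci] := is_cvg_exp_coef_ReIm A m i j s; split => /=.
- by under eq_fun do rewrite (exp_psum_entry _ _ _ _ _ _).1.
- by under eq_fun do rewrite (exp_psum_entry _ _ _ _ _ _).2.
Qed.

Lemma exp_diff_derive A m s : mx_is_derive s (exp_diff A m) (exp_diff A m.+1 s).
Proof.
move=> i j; rewrite mxE; split => /=; under eq_fun do rewrite mxE /=;
  by apply: is_derive_exp_coef => z; rewrite /cnorm1 ?lerDl ?lerDr.
Qed.

Lemma exp_diff0 A s : exp_diff A 0 s = expmx (s%:C *: A).
Proof.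
have eqS n : \sum_(k < n) (k`!%:R)^-1 *: (s%:C *: A) ^+ k = exp_diff_psum A 0 s n.
  apply: eq_bigr => k _; rewrite exprZn scalerA addn0; congr (_ *: _).
  by rewrite rmorphM rmorphXn fmorphV rmorph_nat.
apply/matrixP => i j; rewrite !mxE; congr (limn _ +i* limn _); apply/funext => n.
- by rewrite eqS (exp_psum_entry _ _ _ _ _ _).1.
- by rewrite eqS (exp_psum_entry _ _ _ _ _ _).2.
Qed.

Lemma exp_diffS A m s : exp_diff A m.+1 s = A *m exp_diff A m s.
Proof.
apply/matrixP => i j; apply: c_cvg_unique (cvg_exp_psum _ _ _ _ _) _.
have ES n : exp_diff_psum A m.+1 s n = A *m exp_diff_psum A m s n.
  rewrite mulmx_sumr; apply: eq_bigr => k _.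
  by rewrite -scalemxAr addnS exprS.
rewrite mxE; under eq_fun do rewrite ES mxE.
by apply: c_cvg_sum => k; apply: c_cvgMl; exact: cvg_exp_psum.
Qed.

Lemma expmx_derive A s :
  mx_is_derive s (fun u => expmx (u%:C *: A)) (A *m expmx (s%:C *: A)).
Proof.
rewrite -exp_diff0 -exp_diffS; under eq_fun do rewrite -exp_diff0.
exact: exp_diff_derive.
Qed.

Lemma expmx0 : expmx (0 : 'M[R[i]]_N.+1) = 1%:M.
Proof.
rewrite -(scaler0 _ 1%:C) -exp_diff0.
apply/matrixP => i j; apply: c_cvg_unique (cvg_exp_psum _ _ _ _ _) _.
suff e : \forall n \near \oo, exp_diff_psum 0 0 1 n i j = (1%:M : 'M[R[i]]_N.+1) i j.
  by split; apply: cvg_near_cst; apply: filterS e => n ->.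
exists 1%N => // -[//|n] _; rewrite /exp_diff_psum big_ord_recl big1 => [|k _].
  by rewrite addr0 fact0 expr0 mulr1 invr1 scale1r.
by rewrite addn0 lift0 [(0 : _) ^+ _]exprS mul0r scaler0.
Qed.

End MatrixExponential.

(** * Positive solutions of the exponential flow *)

Section Weight.
Variables (R : realType) (N : nat).

Lemma adjmxM m n p (A : 'M[R[i]]_(m, n)) (B : 'M[R[i]]_(n, p)) :
  (A *m B)^t* = B^t* *m A^t*.
Proof. by rewrite trmx_mul map_mxM. Qed.

Lemma adj_real_scale m n (r : R) (A : 'M[R[i]]_(m, n)) :
  (r%:C *: A)^t* = r%:C *: A^t*.
Proof. by apply/matrixP => i j; rewrite !mxE rmorphM /= [X in X * _]conjc_real. Qed.

Lemma adj_real_scaleN m n (r : R) (A : 'M[R[i]]_(m, n)) :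
  (- r%:C *: A)^t* = - r%:C *: A^t*.
Proof. by rewrite -[- _%:C](rmorphN (real_complex R)) adj_real_scale. Qed.

(** If [f' <= 0] at [t] then, [f'] being nondecreasing, [f] is nonincreasing on
    [[a, t]]; otherwise it is nondecreasing on [[t, b]]. *)
Lemma convex_le_max (f g h : R -> R) (a b t : R) : a <= t <= b ->
  (forall s, a <= s <= b -> is_derive s 1 f (g s)) ->
  (forall s, a <= s <= b -> is_derive s 1 g (h s)) ->
  (forall s, a <= s <= b -> 0 <= h s) ->
  f t <= Num.max (f a) (f b).
Proof.
move=> /andP[at_ tb] df dg h0.
have cont (k l : R -> R) u v : a <= u -> v <= b ->
    (forall s, a <= s <= b -> is_derive s 1 k (l s)) -> {within `[u, v], continuous k}.
  move=> au vb dk; apply: derivable_within_continuous => s.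
  rewrite in_itv /= => /andP[us sv].
  by apply: ex_derive; apply: dk; rewrite (le_trans au)//= (le_trans sv).
have gmono : {in `[a, b]%R &, {homo g : x y / x <= y}}.
  apply: ger0_derive1_le_cc; last exact: cont dg.
  - move=> s; rewrite in_itv /= => /andP[/ltW as_ /ltW sb].
    by apply: ex_derive; apply: dg; rewrite as_.
  - move=> s; rewrite in_itv /= => /andP[/ltW as_ /ltW sb].
    have ab : a <= s <= b by rewrite as_.
    by rewrite derive1E (@derive_val _ _ _ _ _ _ _ (dg s ab)) h0.
have tI : t \in `[a, b]%R by rewrite in_itv /= at_.
rewrite le_max; have [gt0|gt0] := leP (g t) 0.
- apply/orP; left.
  have : {in `[a, t]%R &, {homo f : x y /~ x <= y}}.
    apply: ler0_derive1_le_cc; last exact: cont df.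
    + move=> s; rewrite in_itv /= => /andP[/ltW as_ /ltW sb].
      by apply: ex_derive; apply: df; rewrite as_ (le_trans sb).
    + move=> s; rewrite in_itv /= => /andP[/ltW as_ /ltW sb].
      have ab : a <= s <= b by rewrite as_ (le_trans sb).
      rewrite derive1E (@derive_val _ _ _ _ _ _ _ (df s ab)).
      by apply: le_trans gt0; apply: gmono; rewrite ?in_itv.
  by apply; rewrite ?in_itv /= ?lexx ?at_.
- apply/orP; right.
  have : {in `[t, b]%R &, {homo f : x y / x <= y}}.
    apply: ger0_derive1_le_cc; last exact: cont df.
    + move=> s; rewrite in_itv /= => /andP[/ltW as_ /ltW sb].
      by apply: ex_derive; apply: df; rewrite sb (le_trans _ as_).
    + move=> s; rewrite in_itv /= => /andP[/ltW as_ /ltW sb].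
      have ab : a <= s <= b by rewrite sb (le_trans _ as_).
      rewrite derive1E (@derive_val _ _ _ _ _ _ _ (df s ab)).
      by apply: le_trans (ltW gt0) _; apply: gmono; rewrite ?in_itv.
  by apply; rewrite ?in_itv /= ?lexx ?tb.
Qed.

Lemma posdef_adj (A : 'M[R[i]]_N.+1) : posdefmx A -> A^t* = A.
Proof. by move=> [/is_hermitianmxP]; rewrite expr0 scale1r. Qed.

Lemma posdef_ge0 (A : 'M[R[i]]_N.+1) (v : 'rV_N.+1) : posdefmx A ->
  0 <= complex.Re ((v *m A *m v^t*) 0 0).
Proof.
move=> [_ pA]; have [->|v0] := eqVneq v 0; first by rewrite !mul0mx mxE.
by have := pA v v0; rewrite ltcE => /andP[_ /ltW].
Qed.

(** Everything used of the weight at a fixed point [x] is that it solves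
    [V' = - x L V] and is positive definite on [I]. *)
Section ExponentialFlow.
Variables (L : 'M[R[i]]_N.+1) (x : R) (V : R -> 'M[R[i]]_N.+1) (I : set R).
Hypothesis dV : forall t, mx_is_derive t V (- x%:C *: (L *m V t)).
Hypothesis oI : open I.
Hypothesis pV : forall t, I t -> posdefmx (V t).

(** Differentiate the equality of [V t] and its adjoint: both sides have a known
    derivative.  The factor [x] cannot be cancelled at [x = 0]. *)
Lemma flow_intertwine t : I t -> x%:C *: (L *m V t) = x%:C *: (V t *m L^t*).
Proof.
move=> It; have VA u : I u -> (V u)^t* = V u by move=> /pV/posdef_adj.
have d1 := mx_is_derive_adj (dV t).
have d2 : mx_is_derive t V ((- x%:C *: (L *m V t))^t*).
  apply: mx_is_derive_near d1.
  by apply: filterS (open_nbhs_nbhs _); [exact: VA | split].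
have := mx_is_derive_unique (dV t) d2.
rewrite adj_real_scaleN adjmxM (VA t It).
by rewrite !scaleNr => /oppr_inj.
Qed.

Let q (u w : 'rV[R[i]]_N.+1) s := complex.Re ((u *m V s *m w^t*) 0 0).

Let dq u w (s : R) : is_derive s 1 (q u w) (q (- x%:C *: (u *m L)) w s).
Proof.
have dM := mx_is_deriveMr (w^t*) (mx_is_deriveMl u (dV s)).
rewrite {2}/q (_ : _ *m w^t* = u *m (- x%:C *: (L *m V s)) *m w^t*); last first.
  by rewrite -!scalemxAr -!scalemxAl !mulmxA.
by case: (dM 0 0).
Qed.

(** As a function of [t] the quadratic form is nonnegative and convex: by the
    intertwining relation its second derivative is the form of the same matrix
    at [x v L]. *)
Lemma flow_form_le (v : 'rV_N.+1) a b t : `[a, b] `<=` I -> a <= t <= b ->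
  complex.Re ((v *m V t *m v^t*) 0 0) <=
  complex.Re ((v *m V a *m v^t*) 0 0) + complex.Re ((v *m V b *m v^t*) 0 0).
Proof.
move=> abI atb.
have abI' s : a <= s <= b -> I s by move=> sab; apply: abI; rewrite /= in_itv.
have ge0 s : a <= s <= b -> 0 <= q v v s by move=> /abI'/pV; exact: posdef_ge0.
have /andP[at_ tb] := atb; have ab := le_trans at_ tb.
apply: (@le_trans _ _ (Num.max (q v v a) (q v v b))); last first.
  by rewrite ge_max lerDl lerDr !ge0// lexx ab.
apply: (convex_le_max atb (fun s _ => dq v v s) (fun s _ => dq _ v s)).
move=> s /abI' Is.
have := posdef_ge0 (- x%:C *: (v *m L)) (pV Is).
rewrite (_ : _ *m _ = - x%:C *: (- x%:C *: (v *m L) *m L) *m V s *m v^t*) //.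
rewrite adj_real_scaleN adjmxM -scalemxAr -!scalemxAl; congr (_ *: _).
have Lx : - x%:C *: (L *m V s) = - x%:C *: (V s *m L^t*).
  by rewrite !scaleNr (flow_intertwine Is).
transitivity (v *m L *m (- x%:C *: (V s *m L^t*)) *m v^t*).
  by rewrite -scalemxAr -scalemxAl !mulmxA.
by rewrite -Lx -scalemxAr -scalemxAl !mulmxA.
Qed.

End ExponentialFlow.
Lemma toda_weight_derive (L : 'M[R[i]]_N.+1) W x t :
  mx_is_derive t (toda_weight L W x) (- x%:C *: (L *m toda_weight L W x t)).
Proof.
have e s : (- (x * s))%:C *: L = s%:C *: ((- x)%:C *: L).
  by rewrite scalerA -rmorphM /= mulrN mulrC.
rewrite /toda_weight; under eq_fun do rewrite e.
have := mx_is_deriveMr (W x) (expmx_derive ((- x)%:C *: L) t).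
by rewrite -e -scalemxAl -scalemxAl mulmxA rmorphN.
Qed.

Lemma toda_weight0 (L : 'M[R[i]]_N.+1) W t : toda_weight L W 0 t = W 0.
Proof. by rewrite /toda_weight mul0r oppr0 scale0r expmx0 mul1mx. Qed.

End Weight.

(** * Positive matrices are bounded by their trace *)

Section TraceBound.
Variables (R : realType) (N : nat).

Definition retr (A : 'M[R[i]]_N.+1) : R := \sum_l complex.Re (A l l).

Lemma form_delta (A : 'M[R[i]]_N.+1) i j :
  (delta_mx (0 : 'I_1) i *m A *m (delta_mx (0 : 'I_1) j)^t*) 0 0 = A i j.
Proof. by rewrite trmx_delta map_delta_mx -rowE -colE !mxE. Qed.

Lemma posdef_diag_ge0 (A : 'M[R[i]]_N.+1) i : posdefmx A -> 0 <= complex.Re (A i i).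
Proof. by move=> /(posdef_ge0 (delta_mx 0 i)); rewrite form_delta. Qed.

Let diag_le_retr (A : 'M[R[i]]_N.+1) i : posdefmx A -> complex.Re (A i i) <= retr A.
Proof.
move=> pA; rewrite /retr (bigD1 i)//= lerDl sumr_ge0// => l _.
exact: posdef_diag_ge0.
Qed.

(** Positivity of the form at [e_i + z e_j] for the four fourth roots of unity [z]
    bounds twice either part of [A i j] by the sum of the diagonal entries
    [i] and [j]. *)
Lemma posdef_entry_le (A : 'M[R[i]]_N.+1) i j : posdefmx A ->
  `|complex.Re (A i j)| <= retr A /\ `|complex.Im (A i j)| <= retr A.
Proof.
move=> pA; have di := diag_le_retr i pA; have dj := diag_le_retr j pA.
have Aji : A j i = (A i j)^* by rewrite -{1}(posdef_adj pA) !mxE.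
have form z : 0 <= complex.Re (A i i + z^* * A i j + z * (A i j)^* + z * z^* * A j j).
  have := posdef_ge0 (delta_mx 0 i + z *: delta_mx 0 j) pA.
  suff -> : (delta_mx (0 : 'I_1) i + z *: delta_mx (0 : 'I_1) j)^t* =
     (delta_mx 0 i)^t* + z^* *: (delta_mx 0 j)^t* :> 'cV_N.+1.
    rewrite !mulmxDl !mulmxDr -!scalemxAl -!scalemxAr scalerA.
    have E (B C D F : 'M[R[i]]_1) a b c :
      (B + a *: C + (b *: D + c *: F)) 0 0 = B 0 0 + a * C 0 0 + b * D 0 0 + c * F 0 0.
      by rewrite !mxE addrA.
    by rewrite E !form_delta Aji.
  by apply/matrixP => k l; rewrite !mxE rmorphD rmorphM.
have := (form 1, form (-1), form 'i, form (-'i)).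
move: di dj; case: (A i i) (A j j) (A i j) => [a a'] [b b'] [c c'] /= di dj.
move=> [[[f1 f2] f3] f4]; split; rewrite ler_norml; apply/andP; split; lra.
Qed.

(** The domination used under the integral: the bound depends on [a] and [b] only. *)
Lemma flow_retr_le (L : 'M[R[i]]_N.+1) x (V : R -> 'M[R[i]]_N.+1) (I : set R) a b t :
  (forall t, mx_is_derive t V (- x%:C *: (L *m V t))) -> open I ->
  (forall t, I t -> posdefmx (V t)) -> `[a, b] `<=` I -> a <= t <= b ->
  retr (V t) <= retr (V a) + retr (V b).
Proof.
move=> dV oI pV abI atb; rewrite /retr -big_split /=; apply: ler_sum => l _.
by have := flow_form_le dV oI pV (delta_mx 0 l) abI atb; rewrite !form_delta.
Qed.

End TraceBound.

(** * Integrals of complex matrix functions *)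

Section MatrixIntegrals.
Variables (R : realType) (mu : {measure set (measurableTypeR R) -> \bar R}).
Variable D : set R.
Hypothesis mD : measurable (D : set (measurableTypeR R)).
Implicit Types f g : R -> R.

Local Notation integrable f := (mu.-integrable D (fun x => (f x)%:E)).

Lemma r_integrableD f g : integrable f -> integrable g -> integrable (fun x => f x + g x).
Proof. by move=> fi gi; exact: (integrableD mD fi gi). Qed.

Lemma r_integrableMl (a : R) f : integrable f -> integrable (fun x => a * f x).
Proof. by move=> fi; exact: (integrableZl mD a fi). Qed.

Definition c_integrable (f : R -> R[i]) : Prop :=
  integrable (fun x => complex.Re (f x)) /\ integrable (fun x => complex.Im (f x)).

Definition c_integral (f : R -> R[i]) : R[i] :=
  (\int[mu]_(x in D) complex.Re (f x)) +i* (\int[mu]_(x in D) complex.Im (f x)).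

Lemma c_integrableD (f g : R -> R[i]) : c_integrable f -> c_integrable g ->
  c_integrable (fun x => f x + g x).
Proof.
move=> [fr fi] [gr gi]; split.
- by under eq_fun do rewrite ReD; exact: r_integrableD.
- by under eq_fun do rewrite ImD; exact: r_integrableD.
Qed.

Lemma c_integralD (f g : R -> R[i]) : c_integrable f -> c_integrable g ->
  c_integral (fun x => f x + g x) = c_integral f + c_integral g.
Proof.
move=> [fr fi] [gr gi]; apply: complexP; rewrite ?ReD ?ImD /c_integral /=.
- by rewrite -RintegralD//; apply: eq_Rintegral => x _; rewrite ReD.
- by rewrite -RintegralD//; apply: eq_Rintegral => x _; rewrite ImD.
Qed.

Let ReM' (a z : R[i]) :
  complex.Re (a * z) = complex.Re a * complex.Re z + - complex.Im a * complex.Im z.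
Proof. by rewrite ReM mulNr. Qed.

Lemma c_integrableMl (a : R[i]) (f : R -> R[i]) :
  c_integrable f -> c_integrable (fun x => a * f x).
Proof.
move=> [fr fi]; split.
- by under eq_fun do rewrite ReM'; apply: r_integrableD; exact: r_integrableMl.
- by under eq_fun do rewrite ImM; apply: r_integrableD; exact: r_integrableMl.
Qed.

Lemma c_integralMl (a : R[i]) (f : R -> R[i]) : c_integrable f ->
  c_integral (fun x => a * f x) = a * c_integral f.
Proof.
move=> [fr fi]; apply: complexP; rewrite ?ReM' ?ImM /c_integral /=.
- rewrite -!RintegralZl// -RintegralD//; try exact: r_integrableMl.
  by apply: eq_Rintegral => x _; rewrite ReM'.
- rewrite -!RintegralZl// -RintegralD//; try exact: r_integrableMl.
  by apply: eq_Rintegral => x _; rewrite ImM.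
Qed.

Lemma c_integral_sum (J : Type) (r : seq J) (f : J -> R -> R[i]) :
  (forall j, c_integrable (f j)) ->
  c_integrable (fun x => \sum_(j <- r) f j x) /\
  c_integral (fun x => \sum_(j <- r) f j x) = \sum_(j <- r) c_integral (f j).
Proof.
move=> fi; elim: r => [|j r [IH1 IH2]].
  rewrite big_nil; under [X in c_integrable X]eq_fun do rewrite big_nil.
  split; first by split; exact: integrable0.
  under [X in c_integral X]eq_fun do rewrite big_nil.
  by apply: complexP; rewrite /= Rintegral_cst// mul0r.
rewrite big_cons -IH2 -c_integralD//.
under [X in c_integrable X]eq_fun do rewrite big_cons.
split; first exact: c_integrableD.
by congr c_integral; apply/funext => x; rewrite big_cons.
Qed.

Lemma mx_integralE m n (F : R -> 'M[R[i]]_(m, n)) i j :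
  mx_integral mu D F i j = c_integral (fun x => F x i j).
Proof. by rewrite mxE. Qed.

Lemma mx_integralMl m n p (A : 'M[R[i]]_(p, m)) (F : R -> 'M[R[i]]_(m, n)) :
  mx_integrable mu D F ->
  mx_integrable mu D (fun x => A *m F x) /\
  mx_integral mu D (fun x => A *m F x) = A *m mx_integral mu D F.
Proof.
move=> Fi.
have AF i j : (fun x => (A *m F x) i j) = (fun x => \sum_k A i k * F x k j).
  by apply/funext => x; rewrite mxE.
have s i j := @c_integral_sum _ (index_enum _) (fun k x => A i k * F x k j)
   (fun k => c_integrableMl (A i k) (Fi k j)).
split.
- by move=> i j; have [+ _] := s i j; rewrite -AF.
- apply/matrixP => i j; rewrite mx_integralE AF (s i j).2 mxE.
  by apply: eq_bigr => k _; rewrite mx_integralE c_integralMl//; exact: Fi.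
Qed.

Lemma mx_integralMr m n p (F : R -> 'M[R[i]]_(m, n)) (A : 'M[R[i]]_(n, p)) :
  mx_integrable mu D F ->
  mx_integrable mu D (fun x => F x *m A) /\
  mx_integral mu D (fun x => F x *m A) = mx_integral mu D F *m A.
Proof.
move=> Fi.
have AF i j : (fun x => (F x *m A) i j) = (fun x => \sum_k A k j * F x i k).
  by apply/funext => x; rewrite mxE; apply: eq_bigr => k _; rewrite mulrC.
have s i j := @c_integral_sum _ (index_enum _) (fun k x => A k j * F x i k)
   (fun k => c_integrableMl (A k j) (Fi i k)).
split.
- by move=> i j; have [+ _] := s i j; rewrite -AF.
- apply/matrixP => i j; rewrite mx_integralE AF (s i j).2 mxE.
  by apply: eq_bigr => k _; rewrite mx_integralE mulrC c_integralMl//; exact: Fi.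
Qed.

Lemma mx_integral_sum m n (J : Type) (r : seq J) (F : J -> R -> 'M[R[i]]_(m, n)) :
  (forall j, mx_integrable mu D (F j)) ->
  mx_integrable mu D (fun x => \sum_(j <- r) F j x) /\
  mx_integral mu D (fun x => \sum_(j <- r) F j x) = \sum_(j <- r) mx_integral mu D (F j).
Proof.
move=> Fi.
have AF i j : (fun x => (\sum_(k <- r) F k x) i j) = (fun x => \sum_(k <- r) F k x i j).
  by apply/funext => x; rewrite summxE.
have s i j := @c_integral_sum _ r (fun k x => F k x i j) (fun k => Fi k i j).
split.
- by move=> i j; have [+ _] := s i j; rewrite -AF.
- apply/matrixP => i j; rewrite mx_integralE AF (s i j).2 summxE.
  by apply: eq_bigr => k _; rewrite mx_integralE.
Qed.

(** Without an atom at [0], the point [0] is a null set. *)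
Lemma eq_mx_integral_off0 m n (F G : R -> 'M[R[i]]_(m, n)) :
  mx_integrable mu D F -> mx_integrable mu D G ->
  (forall x, D x -> x != 0 -> F x = G x) ->
  ((0 < mu [set 0%R])%E -> D 0 -> F 0 = G 0) ->
  mx_integral mu D F = mx_integral mu D G.
Proof.
move=> Fi Gi FG FG0.
have ae_int (f g : R -> R) : integrable f -> integrable g ->
    (forall x, F x = G x -> f x = g x) ->
    \int[mu]_(x in D) f x = \int[mu]_(x in D) g x.
  move=> fi gi fg; congr fine; apply: ae_eq_integral => //;
    [exact: measurable_int fi|exact: measurable_int gi|].
  have [mu0|mu0] := eqVneq (mu [set 0%R]) 0%E.
    exists [set 0%R]; split => // x /= /not_implyP[Dx].
    by apply: contra_notP => /eqP x0; rewrite (fg _ (FG _ Dx x0)).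
  apply: aeW => x Dx; rewrite (fg x)//; have [x0|] := eqVneq x 0; last exact: FG.
  by rewrite x0 in Dx *; apply: FG0 => //; rewrite lt0e mu0 measure_ge0.
apply/matrixP => i j; have [fr fi] := Fi i j; have [gr gi] := Gi i j.
by rewrite !mxE; congr (_ +i* _); apply: ae_int => // x ->.
Qed.

End MatrixIntegrals.

Section DerivativeUnderIntegral.
Variables (R : realType) (mu : {measure set (measurableTypeR R) -> \bar R}).
Variables (D : set R) (f f' : R -> R -> R) (G : R -> R) (a u v : R).
Hypothesis mD : measurable (D : set (measurableTypeR R)).
Hypothesis auv : u < a < v.
Hypothesis intf : forall t, u < t < v -> mu.-integrable D (fun x => (f t x)%:E).
Hypothesis df : forall t x, u < t < v -> D x -> is_derive t 1 (f ^~ x) (f' t x).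
Hypothesis G0 : forall x, 0 <= G x.
Hypothesis Gi : mu.-integrable D (fun x => (G x)%:E).
Hypothesis f'G : forall t x, u < t < v -> D x -> `|f' t x| <= G x.

Lemma is_derive_under_integral :
  is_derive a 1 (fun t => \int[mu]_(x in D) f t x) (\int[mu]_(x in D) f' a x).
Proof.
have d1E t x : u < t < v -> D x -> partial1of2 f t x = f' t x.
  by move=> tuv Dx; rewrite partial1of2E; apply: derive_val; exact: df.
have Iuv t : `]u, v[%classic t -> u < t < v by rewrite /= in_itv.
have Ia : `]u, v[%classic a by rewrite /= in_itv.
have intf' t : `]u, v[%classic t -> mu.-integrable D (EFin \o f t).
  by move=> /Iuv; exact: intf.
have derf t x : `]u, v[%classic t -> D x -> derivable (f ^~ x) t 1.
  by move=> /Iuv tuv Dx; apply: ex_derive; exact: df.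
have G_ub t x : `]u, v[%classic t -> D x -> `|partial1of2 f t x| <= G x.
  by move=> /Iuv tuv Dx; rewrite d1E//; exact: f'G.
apply: DeriveDef.
- exact: (derivable_under_integral mD Ia intf' derf G0 Gi G_ub).
- rewrite -derive1E (differentiation_under_integral mD Ia intf' derf G0 Gi G_ub).
  by apply: eq_Rintegral => x; rewrite inE => Dx; exact: d1E.
Qed.

End DerivativeUnderIntegral.

(** * Moments of the deformed weight *)

Section Moments.
Variables (R : realType) (N : nat).
Variables (mu : {measure set (measurableTypeR R) -> \bar R}) (D I : set R).
Variables (L : 'M[R[i]]_N.+1) (V : R -> R -> 'M[R[i]]_N.+1).
Hypothesis mD : measurable (D : set (measurableTypeR R)).
Hypothesis oI : open I.
Hypothesis dV : forall x t, mx_is_derive t (V x) (- x%:C *: (L *m V x t)).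
Hypothesis pV : forall x t, D x -> I t -> posdefmx (V x t).
Hypothesis iV : forall (k : nat) t, I t ->
  mx_integrable mu D (fun x => (x ^+ k)%:C *: V x t).

Definition moment k t := mx_integral mu D (fun x => (x ^+ k)%:C *: V x t).

(** Off [x = 0] the relation for [V] follows from positivity; an atom of [mu] at [0]
    makes the value at [0] count as well. *)
Lemma moment_intertwine k t : I t ->
  ((0 < mu [set 0%R])%E -> L *m V 0 t = V 0 t *m L^t*) ->
  L *m moment k t = moment k t *m L^t*.
Proof.
move=> It V0.
have [il <-] := mx_integralMl mD L (iV k It).
have [ir <-] := mx_integralMr mD (L^t*) (iV k It).
apply: eq_mx_integral_off0 => // [x Dx x0|mu0 D0].
- rewrite -scalemxAr -scalemxAl; congr (_ *: _).
  have x0' : x%:C != 0 :> R[i] by rewrite eq_complex /= eqxx andbT.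
  by have := flow_intertwine (dV x) oI (fun s => @pV x s Dx) It; apply: scalerI.
- by rewrite -scalemxAr -scalemxAl V0.
Qed.

(** The common treatment of the real and the imaginary part: differentiate under
    the integral on a compact neighbourhood [[t - e, t + e]] of [t] in [I]. *)
Let moment_part_derive (part : R[i] -> R) k (t : R) i j :
  (forall r z, part (r%:C * z) = r * part z) ->
  (forall z, `|part z| <= cnorm1 z) ->
  (forall t, I t -> mu.-integrable D (fun x => (part (((x ^+ k)%:C *: V x t) i j))%:E)) ->
  (forall x (t : R), is_derive t 1 (fun s => part (V x s i j))
                             (part ((- x%:C *: (L *m V x t)) i j))) ->
  I t ->
  is_derive t 1 (fun s => \int[mu]_(x in D) part (((x ^+ k)%:C *: V x s) i j))
    (\int[mu]_(x in D) part (((x ^+ k)%:C *: (- x%:C *: (L *m V x t))) i j)).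
Proof.
move=> partM part1 ipart dVpart It.
have [e /= e0 eI] : exists2 e : R, 0 < e & `[t - e, t + e] `<=` I.
  have /nbhs_ballP[e /= e0 eI] := open_nbhs_nbhs (conj oI It).
  exists (e / 2); first by rewrite divr_gt0.
  move=> s /=; rewrite in_itv /= => /andP[st1 st2]; apply: eI.
  rewrite /ball /= ltr_norml; apply/andP; split; lra.
(* [c] bounds the effect of multiplying by [L]; the factor 2 is the one between
   [cnorm1] and the trace bound on the two parts of an entry. *)
pose c := \sum_i \sum_l (cnorm1 (L i l) *+ 2).
pose G x := `|c * (x ^+ k.+1 * retr (V x (t - e)) + x ^+ k.+1 * retr (V x (t + e)))|.
have I1 : I (t - e) by apply: eI; rewrite /= in_itv /= lexx /=; lra.
have I2 : I (t + e) by apply: eI; rewrite /= in_itv /= lexx andbT; lra.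
have c1_ge0 z : 0 <= cnorm1 z :> R by rewrite addr_ge0.
have te : t - e < t < t + e by apply/andP; split; lra.
pose f s x := part (((x ^+ k)%:C *: V x s) i j).
pose f' s x := part (((x ^+ k)%:C *: (- x%:C *: (L *m V x s))) i j).
have iretr s : I s -> mu.-integrable D (fun x => (x ^+ k.+1 * retr (V x s))%:E).
  move=> Is; rewrite /retr; under eq_fun do rewrite mulr_sumr -sumEFin.
  apply: integrable_sum => // l _.
  have [+ _] := iV k.+1 Is l l.
  by under eq_fun do rewrite mxE ReM mul0r subr0.
apply: (@is_derive_under_integral _ mu D f f' G t (t - e) (t + e) mD te).
- move=> s /andP[/ltW s1 /ltW s2]; apply: ipart; apply: eI.
  by rewrite /= in_itv /= s1.
- move=> s x se Dx; rewrite /f /f' mxE partM.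
  under eq_fun do rewrite mxE partM.
  apply: r_is_derive_eq (r_is_deriveM (is_derive_cst _ _ _) (dVpart x s)) _.
  by rewrite mul0r add0r.
- by move=> x; exact: normr_ge0.
- rewrite /G; apply: integrable_norm.
  apply: r_integrableMl => //; apply: r_integrableD => //; exact: iretr.
- move=> s x /andP[/ltW s1 /ltW s2] Dx.
  have I12 : `[t - e, t + e]%classic `<=` I by [].
  have Is : I s by apply: eI; rewrite /= in_itv /= s1.
  have s12 : t - e <= s <= t + e by rewrite s1.
  have le_s := flow_retr_le (dV x) oI (fun u => @pV x u Dx) I12 s12.
  have retr0 : 0 <= retr (V x s).
    by apply: sumr_ge0 => l _; exact: posdef_diag_ge0 (pV Dx Is).
  have c0 : 0 <= c.
    by apply: sumr_ge0 => a _; apply: sumr_ge0 => b _; rewrite mulrn_wge0.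
  have -> : f' s x = - (x ^+ k.+1 * part ((L *m V x s) i j)).
    rewrite /f' mxE partM mxE -[- _%:C](rmorphN (real_complex R)) partM.
    by rewrite mulrA mulrN exprSr mulNr.
  rewrite normrN /G -mulrDr mulrCA !normrM ler_wpM2l// -normrM.
  apply: le_trans (part1 _) _; rewrite mxE.
  apply: le_trans (cnorm1_sum _) _.
  apply: (@le_trans _ _ (c * retr (V x s))); last first.
    by apply: le_trans (ler_norm _); rewrite ler_wpM2l.
  rewrite /c mulr_suml [X in _ <= X](bigD1 i)//= mulr_suml.
  rewrite -[X in X <= _]addr0 lerD//; last first.
    apply: sumr_ge0 => l _; rewrite mulr_ge0 ?retr0// sumr_ge0// => n _.
    by rewrite mulrn_wge0.
  apply: ler_sum => l _; apply: le_trans (cnorm1M _ _) _.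
  have [re im] := posdef_entry_le l j (pV Dx Is).
  by rewrite mulrnAl -mulrnAr ler_wpM2l// mulr2n lerD.
Qed.

Lemma moment_derive k t : I t -> mx_is_derive t (moment k) (- (L *m moment k.+1 t)).
Proof.
move=> It.
have -> : - (L *m moment k.+1 t) = mx_integral mu D
    (fun x => (x ^+ k)%:C *: (- x%:C *: (L *m V x t))).
  rewrite -mulNmx -(mx_integralMl mD (- L) (iV k.+1 It)).2.
  congr mx_integral; apply/funext => x.
  by rewrite scalerA mulrN -rmorphM /= -exprSr scaleNr scalemxAr mulNmx.
move=> i j; rewrite /moment mxE; split => /=; under eq_fun do rewrite mxE /=.
- apply: (@moment_part_derive (@complex.Re R) k t i j) It.
  + by move=> r [a b] /=; ring.
  + by move=> z; rewrite lerDl.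
  + by move=> s /(iV k)/(_ i j)[].
  + by move=> x s; case: (dV x s i j).
- apply: (@moment_part_derive (@complex.Im R) k t i j) It.
  + by move=> r [a b] /=; ring.
  + by move=> z; rewrite lerDr.
  + by move=> s /(iV k)/(_ i j)[].
  + by move=> x s; case: (dV x s i j).
Qed.

End Moments.

(** * Orthogonal polynomials for a noncommutative moment functional *)

Section MomentPairing.
Variable A : nzRingType.
Implicit Types (M : nat -> A) (F G Q : {poly A}) (c : A).

(** The right argument is not conjugated: adjoint polynomials will be substituted
    for it, which keeps the form bilinear and the theory valid over any ring. *)
Definition pairing M F G : A :=
  \sum_(i < size F) \sum_(j < size G) F`_i * M (i + j)%N * G`_j.

Lemma pairing_bound M F G a b : (size F <= a)%N -> (size G <= b)%N ->
  pairing M F G = \sum_(i < a) \sum_(j < b) F`_i * M (i + j)%N * G`_j.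
Proof.
move=> Fa Gb; rewrite /pairing.
rewrite (big_ord_widen _ (fun i => \sum_(j < size G) F`_i * M (i + j)%N * G`_j) Fa).
rewrite [RHS](bigID (fun i : 'I_a => (i < size F)%N)) /= [X in _ + X]big1 ?addr0.
  apply: eq_bigr => i _.
  rewrite (big_ord_widen _ (fun j => F`_i * M (i + j)%N * G`_j) Gb).
  rewrite [RHS](bigID (fun j : 'I_b => (j < size G)%N)) /= [X in _ + X]big1 ?addr0//.
  by move=> j; rewrite -leqNgt => Gj; rewrite (nth_default 0 Gj) mulr0.
move=> i; rewrite -leqNgt => Fi; rewrite big1// => j _.
by rewrite (nth_default 0 Fi) !mul0r.
Qed.

Lemma pairingDl M F1 F2 G : pairing M (F1 + F2) G = pairing M F1 G + pairing M F2 G.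
Proof.
pose a := maxn (size F1) (size F2).
rewrite !(@pairing_bound _ _ G a (size G)) ?size_polyD ?leq_maxl ?leq_maxr//.
rewrite -big_split; apply: eq_bigr => i _; rewrite -big_split; apply: eq_bigr => j _.
by rewrite coefD !mulrDl.
Qed.

Lemma pairingDr M F G1 G2 : pairing M F (G1 + G2) = pairing M F G1 + pairing M F G2.
Proof.
pose b := maxn (size G1) (size G2).
rewrite !(@pairing_bound _ F _ (size F) b) ?size_polyD ?leq_maxl ?leq_maxr//.
rewrite -big_split; apply: eq_bigr => i _; rewrite -big_split; apply: eq_bigr => j _.
by rewrite coefD mulrDr.
Qed.

Lemma pairing0l M G : pairing M 0 G = 0.
Proof. by rewrite /pairing size_poly0 big_ord0. Qed.

Lemma pairing0r M F : pairing M F 0 = 0.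
Proof. by rewrite /pairing big1// => i _; rewrite size_poly0 big_ord0. Qed.

Lemma size_mulC_le c F : (size (c%:P * F)%R <= size F)%N.
Proof. by apply/leq_sizeP => j Fj; rewrite coefCM nth_default ?mulr0. Qed.

Lemma size_mulCr_le c F : (size (F * c%:P)%R <= size F)%N.
Proof. by apply/leq_sizeP => j Fj; rewrite coefMC nth_default ?mul0r. Qed.

Lemma pairingCl M c F G : pairing M (c%:P * F) G = c * pairing M F G.
Proof.
rewrite (@pairing_bound _ _ G (size F) (size G)) ?size_mulC_le// /pairing.
rewrite mulr_sumr; apply: eq_bigr => i _; rewrite mulr_sumr; apply: eq_bigr => j _.
by rewrite coefCM !mulrA.
Qed.

Lemma pairingCr M F G c : pairing M F (G * c%:P) = pairing M F G * c.
Proof.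
rewrite (@pairing_bound _ F _ (size F) (size G)) ?size_mulCr_le// /pairing.
rewrite mulr_suml; apply: eq_bigr => i _; rewrite mulr_suml; apply: eq_bigr => j _.
by rewrite coefMC !mulrA.
Qed.

Lemma pairing_shift M F G :
  pairing M ('X * F) G = pairing (fun k => M k.+1) F G.
Proof.
rewrite (@pairing_bound _ _ G (size F).+1 (size G))//; last first.
  by apply/leq_sizeP => -[|j]//; rewrite coefXM /= => Fj; rewrite nth_default.
rewrite big_ord_recl big1 ?add0r => [|j _]; last by rewrite coefXM !mul0r.
by apply: eq_bigr => i _; apply: eq_bigr => j _; rewrite coefXM lift0 addSn.
Qed.

Lemma pairingXX M F G : pairing M ('X * F) G = pairing M F ('X * G).
Proof.
rewrite pairing_shift (@pairing_bound _ F ('X * G) (size F) (size G).+1)//; last first.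
  by apply/leq_sizeP => -[|j]//; rewrite coefXM /= => Gj; rewrite nth_default.
apply: eq_bigr => i _; rewrite big_ord_recl coefXM mulr0 add0r.
by apply: eq_bigr => j _; rewrite coefXM lift0 addnS.
Qed.

(** [c] moves from left to right past [F], then past the moments, where it turns
    into [c'], then past [G]. *)
Lemma pairing_intertwine M c c' F G :
  (forall k, c * M k = M k * c') ->
  (forall i, GRing.comm c F`_i) -> (forall j, GRing.comm c' G`_j) ->
  c * pairing M F G = pairing M F G * c'.
Proof.
move=> cM cF cG; rewrite mulr_sumr mulr_suml; apply: eq_bigr => i _.
rewrite mulr_sumr mulr_suml; apply: eq_bigr => j _.
by rewrite !mulrA cF -(mulrA _ c) cM -!mulrA cG.
Qed.

Lemma pairing_momentsMl M c F G : (forall i, GRing.comm c F`_i) ->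
  pairing (fun k => c * M k) F G = c * pairing M F G.
Proof.
move=> cF; rewrite mulr_sumr; apply: eq_bigr => i _.
by rewrite mulr_sumr; apply: eq_bigr => j _; rewrite !mulrA cF.
Qed.

Lemma size_reducel Q F n : size F = n.+1 -> F \is monic -> (size Q <= n.+1)%N ->
  (size (Q - (Q`_n)%:P * F)%R <= n)%N.
Proof.
move=> sF mF sQ; apply/leq_sizeP => j; rewrite coefB coefCM leq_eqVlt => /predU1P[<-|nj].
  by move/monicP: mF; rewrite /lead_coef sF /= => ->; rewrite mulr1 subrr.
by rewrite [F`__]nth_default ?sF// nth_default ?mulr0 ?subr0// (leq_trans sQ).
Qed.

Lemma size_reducer Q F n : size F = n.+1 -> F \is monic -> (size Q <= n.+1)%N ->
  (size (Q - F * (Q`_n)%:P)%R <= n)%N.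
Proof.
move=> sF mF sQ; apply/leq_sizeP => j; rewrite coefB coefMC leq_eqVlt => /predU1P[<-|nj].
  by move/monicP: mF; rewrite /lead_coef sF /= => ->; rewrite mul1r subrr.
by rewrite [F`__]nth_default ?sF// nth_default ?mul0r ?subr0// (leq_trans sQ).
Qed.

(** A biorthogonal pair of monic families; for the inner product of a matrix weight,
    [P'] consists of the adjoints of [P]. *)
Section OrthogonalSystem.
Variables (M : nat -> A) (P P' : nat -> {poly A}) (H : nat -> A).
Hypothesis sP : forall n, size (P n) = n.+1.
Hypothesis mP : forall n, P n \is monic.
Hypothesis sP' : forall n, size (P' n) = n.+1.
Hypothesis mP' : forall n, P' n \is monic.
Hypothesis orth : forall n m, pairing M (P n) (P' m) = if n == m then H n else 0.

(** Induction on the degree, peeling off the leading term as a left multiple of some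
    [P s] with [s < n]; the lemma after it peels off right multiples of [P' s]. *)
Lemma orthogonal_left n Q : (size Q <= n)%N -> pairing M Q (P' n) = 0.
Proof.
suff orth_s s : (s <= n)%N -> forall Q, (size Q <= s)%N -> pairing M Q (P' n) = 0.
  exact: orth_s.
elim: s => [_|s IH sn] {}Q.
  by rewrite leqn0 size_poly_eq0 => /eqP ->; exact: pairing0l.
move=> sQ; rewrite -(subrK ((Q`_s)%:P * P s) Q) pairingDl pairingCl orth ltn_eqF//.
by rewrite mulr0 addr0 IH ?(ltnW sn)//; exact: size_reducel.
Qed.

Lemma orthogonal_right n Q : (size Q <= n)%N -> pairing M (P n) Q = 0.
Proof.
suff orth_s s : (s <= n)%N -> forall Q, (size Q <= s)%N -> pairing M (P n) Q = 0.
  exact: orth_s.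
elim: s => [_|s IH sn] {}Q.
  by rewrite leqn0 size_poly_eq0 => /eqP ->; exact: pairing0r.
move=> sQ; rewrite -(subrK (P' s * (Q`_s)%:P) Q) pairingDr pairingCr orth gtn_eqF//.
by rewrite mul0r addr0 IH ?(ltnW sn)//; exact: size_reducer.
Qed.

Lemma pairing_right n Q : (size Q <= n.+1)%N -> pairing M (P n) Q = H n * Q`_n.
Proof.
move=> sQ; rewrite -{1}(subrK (P' n * (Q`_n)%:P) Q) pairingDr pairingCr orth eqxx.
by rewrite orthogonal_right ?add0r//; exact: size_reducer.
Qed.

Lemma pairing_left n Q : (size Q <= n.+1)%N -> pairing M Q (P' n) = Q`_n * H n.
Proof.
move=> sQ; rewrite -{1}(subrK ((Q`_n)%:P * P n) Q) pairingDl pairingCl orth eqxx.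
by rewrite orthogonal_left ?add0r//; exact: size_reducel.
Qed.

Variables B C : nat -> A.
Hypothesis C0 : C 0%N = 0.
Hypothesis rec : forall n, 'X * P n =
  P n.+1 + (B n)%:P * P n + (C n)%:P * (if n is m.+1 then P m else 0).

Lemma recurrence_B n : B n * H n = pairing M ('X * P n) (P' n).
Proof.
rewrite rec !pairingDl !pairingCl !orth eqxx gtn_eqF// add0r.
by case: n => [|n]; rewrite ?pairing0l ?orth ?ltn_eqF// mulr0 addr0.
Qed.

Lemma recurrence_C n : C n.+1 * H n = pairing M ('X * P n.+1) (P' n).
Proof.
by rewrite rec !pairingDl !pairingCl !orth eqxx !gtn_eqF//= ?mulr0 ?add0r.
Qed.

(** The pairing of ['X * P n.+1] with [P' n] is also that of [P n.+1] with
    ['X * P' n], which is monic of degree [n + 1]. *)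
Lemma recurrence_norm n : C n.+1 * H n = H n.+1.
Proof.
rewrite recurrence_C pairingXX pairing_right; last first.
  by apply/leq_sizeP => -[|j]//; rewrite coefXM /= => nj; rewrite nth_default ?sP'.
have /monicP := mP' n; rewrite /lead_coef sP' /= => P'n.
by rewrite coefXM /= P'n mulr1.
Qed.

(** Compare the coefficients of ['X^n] in the recurrence. *)
Lemma recurrence_subleading n :
  B n = (if n is m.+1 then (P n)`_m else 0) - (P n.+1)`_n.
Proof.
have /(congr1 (fun Q : {poly A} => Q`_n)) := rec n.
rewrite coefXM !coefD !coefCM.
have /monicP := mP n; rewrite /lead_coef sP /= => ->; rewrite mulr1.
case: n => [|n] /=.
  by rewrite coef0 mulr0 addr0 => E; apply/eqP; rewrite eq_sym subr_eq addrC -E.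
rewrite [(P n)`__]nth_default ?sP// mulr0 addr0 => ->.
by rewrite addrC addKr.
Qed.

(** Induction: the recurrence coefficients are ratios of pairings of [P n] and of
    the earlier polynomials, and these pairings intertwine [c] and [c']. *)
Lemma orthogonal_comm c c' :
  (forall k, c * M k = M k * c') ->
  (forall n, (forall i, GRing.comm c (P n)`_i) -> forall i, GRing.comm c' (P' n)`_i) ->
  (forall n, GRing.rreg (H n)) ->
  forall n, [/\ forall i, GRing.comm c (P n)`_i, GRing.comm c (B n) & GRing.comm c (C n)].
Proof.
move=> cM cPP' rH.
have cH n : (forall i, GRing.comm c (P n)`_i) -> c * H n = H n * c'.
  move=> cP; have := orth n n; rewrite eqxx => <-.
  by apply: pairing_intertwine => //; exact: cPP'.
have ratio n X K : (forall i, GRing.comm c (P n)`_i) -> X * H n = K ->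
    c * K = K * c' -> GRing.comm c X.
  move=> /cH cHn XH cK; apply: (rH n).
  by rewrite -mulrA XH cK -XH -mulrA -cHn mulrA.
have cB n : (forall i, GRing.comm c (P n)`_i) -> GRing.comm c (B n).
  move=> cP; apply: ratio (cP) (recurrence_B n) _.
  apply: pairing_intertwine => //; last exact: cPP'.
  by case=> [|i]; rewrite coefXM //=; exact: commr0.
have cC n : (forall i, GRing.comm c (P n)`_i) -> (forall i, GRing.comm c (P n.+1)`_i) ->
    GRing.comm c (C n.+1).
  by move=> cP cPS; apply: ratio cP (recurrence_norm n) (cH _ cPS).
pose prevP n : {poly A} := if n is m.+1 then P m else 0.
have step n : (forall i, GRing.comm c (P n)`_i) -> GRing.comm c (C n) ->
    (forall i, GRing.comm c (prevP n)`_i) ->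
    forall i, GRing.comm c (P n.+1)`_i.
  move=> cPn cCn cPm i.
  have -> : P n.+1 = 'X * P n - (B n)%:P * P n - (C n)%:P * prevP n.
    by rewrite rec; apply/esym/eqP; rewrite !subr_eq addrAC.
  rewrite !coefB coefXM !coefCM; apply: commrB; first apply: commrB.
  - by case: (i == 0)%N; [exact: commr0|exact: cPn].
  - by apply: commrM => //; exact: cB.
  - by apply: commrM.
have cP0 i : GRing.comm c (P 0%N)`_i.
  have /size1_polyC -> : (size (P 0%N) <= 1)%N by rewrite sP.
  have /monicP := mP 0; rewrite /lead_coef sP /= => ->.
  by rewrite coefC; case: (i == 0)%N; [exact: commr1|exact: commr0].
have all n : (forall i, GRing.comm c (P n)`_i) /\ (forall i, GRing.comm c (P n.+1)`_i).
  elim: n => [|n [IH1 IH2]]; split=> //.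
    by apply: step => // [|i]; rewrite ?C0 ?coef0; exact: commr0.
  by apply: step => //; exact: cC.
move=> n; split; [exact: (all n).1|exact: cB (all n).1|].
by case: n => [|n]; [rewrite C0; exact: commr0|exact: cC (all n).1 (all n).2].
Qed.

End OrthogonalSystem.
End MomentPairing.

(** * Deformation of the recurrence coefficients *)

Section PolynomialDerivatives.
Variables (R : realType) (N : nat).
Local Notation A := 'M[R[i]]_N.+1.
Implicit Types (t : R) (F G : R -> {poly A}) (M : nat -> R -> A).

Lemma mx_is_derive_mulr t (F G : R -> A) a b : mx_is_derive t F a -> mx_is_derive t G b ->
  mx_is_derive t (fun s => F s * G s) (a * G t + F t * b).
Proof. exact: mx_is_deriveM. Qed.

Lemma mx_derivable_mulr t (F G : R -> A) : mx_derivable t F -> mx_derivable t G ->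
  mx_derivable t (fun s => F s * G s).
Proof. by move=> [a Fa] [b Gb]; eexists; exact: mx_is_derive_mulr. Qed.

Lemma mx_derivableB t (F G : R -> A) : mx_derivable t F -> mx_derivable t G ->
  mx_derivable t (fun s => F s - G s).
Proof. by move=> [a Fa] [b Gb]; eexists; exact: mx_is_deriveB. Qed.

Lemma mx_derivable_near t (F G : R -> A) :
  (\near t, F t = G t) -> mx_derivable t F -> mx_derivable t G.
Proof. by move=> FG [a Fa]; exists a; exact: mx_is_derive_near Fa. Qed.

Definition poly_is_derive t F (dF : {poly A}) : Prop :=
  forall i, mx_is_derive t (fun s => (F s)`_i) dF`_i.

(** Coefficientwise derivatives assemble into a polynomial of size at most [a] when
    the coefficients from [a] on are locally constant. *)
Lemma poly_derivableP t F a : (forall i, mx_derivable t (fun s => (F s)`_i)) ->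
  (forall i, (a <= i)%N -> exists c, \near t, (F t)`_i = c) ->
  exists2 dF : {poly A}, (size dF <= a)%N & poly_is_derive t F dF.
Proof.
move=> dF Fc; exists (\poly_(i < a) sval (cid (dF i))); first exact: size_poly.
move=> i; rewrite coef_poly; case: ltnP => ia; first by case: cid.
have [c Fic] := Fc i ia.
by apply: mx_is_derive_near (mx_is_derive_cst t c); apply: filterS Fic => s ->.
Qed.

Lemma pairing_derive t a b M (M' : nat -> A) F G (dF dG : {poly A}) :
  (\near t, (size (F t) <= a)%N) -> (\near t, (size (G t) <= b)%N) ->
  (size dF <= a)%N -> (size dG <= b)%N ->
  (forall k, mx_is_derive t (M k) (M' k)) ->
  poly_is_derive t F dF -> poly_is_derive t G dG ->
  mx_is_derive t (fun s => pairing (M ^~ s) (F s) (G s))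
    (pairing (M ^~ t) dF (G t) + pairing M' (F t) (G t) + pairing (M ^~ t) (F t) dG).
Proof.
move=> Fa Gb dFa dGb dM FdF GdG.
have Fat := nbhs_singleton Fa; have Gbt := nbhs_singleton Gb.
apply: (@mx_is_derive_near _ _ _ _
    (fun s => \sum_(i < a) \sum_(j < b) (F s)`_i * M (i + j)%N s * (G s)`_j)).
  by apply: filterS2 Fa Gb => s Fs Gs; rewrite (pairing_bound _ Fs Gs).
rewrite (pairing_bound _ dFa Gbt) !(pairing_bound _ Fat Gbt) (pairing_bound _ Fat dGb).
rewrite -!big_split /=; apply: mx_is_derive_sum => i.
rewrite -!big_split /=; apply: mx_is_derive_sum => j.
rewrite -mulrDl.
by apply: mx_is_derive_mulr => //; exact: mx_is_derive_mulr.
Qed.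

(** The adjoint polynomial turns the sesquilinear matrix inner product into the
    bilinear pairing. *)
Definition adjp (p : {poly A}) : {poly A} := \poly_(i < size p) (p`_i)^t*.

Lemma adjmx0 m n : (0 : 'M[R[i]]_(m, n))^t* = 0.
Proof. by rewrite trmx0 map_mx0. Qed.

Lemma coef_adjp p i : (adjp p)`_i = (p`_i)^t*.
Proof.
by rewrite coef_poly; case: ltnP => // pi; rewrite nth_default// adjmx0.
Qed.

Lemma size_adjp p : size (adjp p) = size p.
Proof.
apply/eqP; rewrite eqn_leq size_poly /=; apply/leq_sizeP => i pi.
by have := coef_adjp p i; rewrite nth_default// => /esym/(congr1 (fun B : A => B^t*));
  rewrite trmxCK adjmx0.
Qed.

Lemma adjp_monic p : p \is monic -> adjp p \is monic.
Proof.
move=> /monicP; rewrite /lead_coef => p1; apply/monicP.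
by rewrite /lead_coef size_adjp coef_adjp p1 trmx1 map_mx1.
Qed.

Lemma adjp_derive t F dF :
  poly_is_derive t F dF -> poly_is_derive t (fun s => adjp (F s)) (adjp dF).
Proof.
move=> FdF i; rewrite coef_adjp; under eq_fun do rewrite coef_adjp.
exact: mx_is_derive_adj.
Qed.

End PolynomialDerivatives.

Section TodaEquations.
Variables (R : realType) (N : nat).
Local Notation A := 'M[R[i]]_N.+1.
Variables (I : set R) (L : A) (M : nat -> R -> A) (P : nat -> R -> {poly A}).
Variables (B C : nat -> R -> A).
Hypothesis oI : open I.
Hypothesis dM : forall k s, I s -> mx_is_derive s (M k) (- (L * M k.+1 s)).
Hypothesis LM : forall k s, I s -> L * M k s = M k s * L^t*.
Hypothesis sP : forall n s, I s -> size (P n s) = n.+1.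
Hypothesis mP : forall n s, I s -> P n s \is monic.

Definition sqnorm n s : A := pairing (M ^~ s) (P n s) (adjp (P n s)).

Hypothesis orth : forall n m s, I s ->
  pairing (M ^~ s) (P n s) (adjp (P m s)) = if n == m then sqnorm n s else 0.
Hypothesis unitH : forall n s, I s -> sqnorm n s \is a GRing.unit.
Hypothesis C0 : forall s, I s -> C 0%N s = 0.
Hypothesis rec : forall n s, I s -> 'X * P n s =
  P n.+1 s + (B n s)%:P * P n s + (C n s)%:P * (if n is m.+1 then P m s else 0).

Let sP' n s : I s -> size (adjp (P n s)) = n.+1.
Proof. by move=> Is; rewrite size_adjp sP. Qed.

Let mP' n s : I s -> adjp (P n s) \is monic.
Proof. by move=> Is; apply: adjp_monic; exact: mP. Qed.

Let orthl n s (Q : {poly A}) : I s -> (size Q <= n)%N ->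
  pairing (M ^~ s) Q (adjp (P n s)) = 0.
Proof.
move=> Is; exact: (@orthogonal_left _ (M ^~ s) (P ^~ s) (fun n => adjp (P n s))
  (sqnorm ^~ s) (fun n => sP n Is) (fun n => mP n Is) (fun n m => orth n m Is)).
Qed.

Let orthr n s (Q : {poly A}) : I s -> (size Q <= n)%N ->
  pairing (M ^~ s) (P n s) Q = 0.
Proof.
move=> Is; exact: (@orthogonal_right _ (M ^~ s) (P ^~ s) (fun n => adjp (P n s))
  (sqnorm ^~ s) (fun n => sP' n Is) (fun n => mP' n Is) (fun n m => orth n m Is)).
Qed.

Let pairl n s (Q : {poly A}) : I s -> (size Q <= n.+1)%N ->
  pairing (M ^~ s) Q (adjp (P n s)) = Q`_n * sqnorm n s.
Proof.
move=> Is; exact: (@pairing_left _ (M ^~ s) (P ^~ s) (fun n => adjp (P n s))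
  (sqnorm ^~ s) (fun n => sP n Is) (fun n => mP n Is) (fun n m => orth n m Is)).
Qed.

Let normB n s : I s -> B n s * sqnorm n s = pairing (M ^~ s) ('X * P n s) (adjp (P n s)).
Proof.
move=> Is; exact: (@recurrence_B _ (M ^~ s) (P ^~ s) (fun n => adjp (P n s)) (sqnorm ^~ s)
  (fun n m => orth n m Is) (B ^~ s) (C ^~ s) (fun n => rec n Is)).
Qed.

Let pairC n s : I s ->
  C n.+1 s * sqnorm n s = pairing (M ^~ s) ('X * P n.+1 s) (adjp (P n s)).
Proof.
move=> Is; exact: (@recurrence_C _ (M ^~ s) (P ^~ s) (fun n => adjp (P n s)) (sqnorm ^~ s)
  (fun n m => orth n m Is) (B ^~ s) (C ^~ s) (fun n => rec n Is)).
Qed.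

Let normC n s : I s -> C n.+1 s * sqnorm n s = sqnorm n.+1 s.
Proof.
move=> Is; exact: (@recurrence_norm _ (M ^~ s) (P ^~ s) (fun n => adjp (P n s))
  (sqnorm ^~ s) (fun n => sP' n Is) (fun n => mP' n Is) (fun n m => orth n m Is)
  (B ^~ s) (C ^~ s) (fun n => rec n Is)).
Qed.

Let subleading n s : I s ->
  B n s = (if n is m.+1 then (P n s)`_m else 0) - (P n.+1 s)`_n.
Proof.
move=> Is; exact: (@recurrence_subleading _ (P ^~ s) (fun n => sP n Is) (fun n => mP n Is)
  (B ^~ s) (C ^~ s) (fun n => rec n Is)).
Qed.

Let comm n s : I s -> [/\ forall i, GRing.comm L (P n s)`_i,
  GRing.comm L (B n s) & GRing.comm L (C n s)].
Proof.
move=> Is; apply: (@orthogonal_comm _ (M ^~ s) (P ^~ s) (fun n => adjp (P n s))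
  (sqnorm ^~ s) (fun n => sP n Is) (fun n => mP n Is) (fun n => sP' n Is)
  (fun n => mP' n Is) (fun n m => orth n m Is)
  (B ^~ s) (C ^~ s) (C0 Is) (fun n => rec n Is) L (L^t*)).
- by move=> k; exact: LM.
- move=> k cP i; rewrite coef_adjp /GRing.comm.
  have cPi : L *m (P k s)`_i = (P k s)`_i *m L := cP i.
  by rewrite -[LHS]adjmxM -cPi adjmxM.
- by move=> k; apply: mulIr; exact: unitH.
Qed.

Variable t : R.
Hypothesis It : I t.

Let nearI (Q : R -> Prop) : (forall s, I s -> Q s) -> \near t, Q t.
Proof. by move=> IQ; apply: filterS (open_nbhs_nbhs (conj oI It)). Qed.

(** The coefficients of degree at least [n] are constant because [P n] is monic, so
    the derivative drops the degree; the later orthogonality arguments rest on this. *)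
Let poly_derivative_lower n : (forall i, mx_derivable t (fun s => (P n s)`_i)) ->
  exists2 dP : {poly A}, (size dP <= n)%N & poly_is_derive t (P n) dP.
Proof.
move=> /poly_derivableP; apply => i; rewrite leq_eqVlt => /predU1P[<-|ni].
  exists 1; apply: nearI => s Is.
  by have /monicP := mP n Is; rewrite /lead_coef sP.
by exists 0; apply: nearI => s Is; rewrite nth_default ?sP.
Qed.

Let shifted_derive n dP : poly_is_derive t (P n) dP ->
  poly_is_derive t (fun s => 'X * P n s) ('X * dP).
Proof.
move=> PdP [|i]; rewrite coefXM /=; under eq_fun do rewrite coefXM /=.
  exact: mx_is_derive_cst.
exact: PdP.
Qed.

Let near_size n : \near t, (size (P n t) <= n.+1)%N.
Proof. by apply: nearI => s Is; rewrite sP. Qed.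

Let near_size' n : \near t, (size (adjp (P n t)) <= n.+1)%N.
Proof. by apply: nearI => s Is; rewrite sP'. Qed.

Let der_sqnorm n : (forall i, mx_derivable t (fun s => (P n s)`_i)) ->
  mx_derivable t (sqnorm n).
Proof.
move=> /poly_derivative_lower[dP sdP PdP]; eexists.
apply: (pairing_derive (near_size n) (near_size' n) _ _ (fun k => dM k It) PdP
   (adjp_derive PdP)); rewrite ?size_adjp; exact: leqW.
Qed.

Let mx_derivable_ratio n (X K : R -> A) : mx_derivable t (sqnorm n) ->
  mx_derivable t K -> (forall s, I s -> X s * sqnorm n s = K s) -> mx_derivable t X.
Proof.
move=> dH dK XHK; apply: (@mx_derivable_near _ _ _ (fun s => K s * invmx (sqnorm n s))).
  by apply: nearI => s Is; rewrite -(XHK s Is) -mulrA mulrV ?mulr1//; exact: unitH.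
apply: mx_derivable_mulr => //; apply: mx_derivableV => //.
by apply: nearI => s Is; exact: unitH.
Qed.

Let der_B n : (forall i, mx_derivable t (fun s => (P n s)`_i)) -> mx_derivable t (B n).
Proof.
move=> dPn; apply: mx_derivable_ratio (der_sqnorm dPn) _ (normB n).
have [dP sdP PdP] := poly_derivative_lower dPn; eexists.
apply: (pairing_derive (a := n.+2) _ (near_size' n) _ _ (fun k => dM k It)
   (shifted_derive PdP) (adjp_derive PdP)).
- apply: nearI => s Is; apply/leq_sizeP => -[|j]//; rewrite coefXM /= => nj.
  by rewrite nth_default ?sP.
- apply/leq_sizeP => -[|j]//; rewrite coefXM /= => nj.
  by rewrite nth_default// (leq_trans sdP)// ltnW.
- by rewrite size_adjp leqW.
Qed.

Let der_C n : (forall i, mx_derivable t (fun s => (P n s)`_i)) ->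
  (forall i, mx_derivable t (fun s => (P n.+1 s)`_i)) -> mx_derivable t (C n.+1).
Proof.
by move=> dPn dPSn; apply: mx_derivable_ratio (der_sqnorm dPn) (der_sqnorm dPSn) (normC n).
Qed.

(** The recurrence expresses [P n.+1] by the earlier polynomials, and its
    coefficients are ratios of pairings of the latter. *)
Let der_P n i : mx_derivable t (fun s => (P n s)`_i).
Proof.
have dcst (c : A) : mx_derivable t (fun=> c) by exists 0; exact: mx_is_derive_cst.
pose prevP n s : {poly A} := if n is m.+1 then P m s else 0.
have step m : (forall i, mx_derivable t (fun s => (P m s)`_i)) ->
    mx_derivable t (C m) -> (forall i, mx_derivable t (fun s => (prevP m s)`_i)) ->
    forall i, mx_derivable t (fun s => (P m.+1 s)`_i).
  move=> dPm dCm dprev j.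
  apply: (@mx_derivable_near _ _ _ (fun s => (if (j == 0)%N then 0 else (P m s)`_j.-1)
     - B m s * (P m s)`_j - C m s * (prevP m s)`_j)).
    apply: nearI => s Is.
    have -> : P m.+1 s = 'X * P m s - (B m s)%:P * P m s - (C m s)%:P * prevP m s.
      by rewrite rec//; apply/esym/eqP; rewrite !subr_eq addrAC.
    by rewrite !coefB coefXM !coefCM.
  apply: mx_derivableB; first apply: mx_derivableB.
  - by case: (j == 0)%N.
  - by apply: mx_derivable_mulr => //; exact: der_B.
  - exact: mx_derivable_mulr.
have all m : (forall i, mx_derivable t (fun s => (P m s)`_i)) /\
             (forall i, mx_derivable t (fun s => (P m.+1 s)`_i)).
  elim: m => [|m [IH1 IH2]].
    have dP0 j : mx_derivable t (fun s => (P 0%N s)`_j).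
      apply: (@mx_derivable_near _ _ _ (fun=> (1 : {poly A})`_j)) => //.
      apply: nearI => s Is; congr (_`_j).
      have /size1_polyC -> : (size (P 0%N s) <= 1)%N by rewrite sP.
      by have /monicP := mP 0 Is; rewrite /lead_coef sP//= => ->.
    split=> //; apply: step => // [|j]; last exact: (dcst (0 : {poly A})`_j).
    by apply: (@mx_derivable_near _ _ _ (fun=> 0)) => //; apply: nearI => s Is; rewrite C0.
  split=> //; apply: step => //; exact: der_C.
exact: (all n).1.
Qed.

(** The moments contribute [- L M_(k+1)].  Since [L] commutes with [P n] it comes out
    on the left, and the index shift is a multiplication by ['X]. *)
Let dpair n m (dP dP' : {poly A}) : (size dP <= n)%N -> poly_is_derive t (P n) dP ->
  (size dP' <= m)%N -> poly_is_derive t (P m) dP' ->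
  mx_is_derive t (fun s => pairing (M ^~ s) (P n s) (adjp (P m s)))
  (pairing (M ^~ t) dP (adjp (P m t))
   - L * pairing (M ^~ t) ('X * P n t) (adjp (P m t))
   + pairing (M ^~ t) (P n t) (adjp dP')).
Proof.
move=> sdP PdP sdP' PdP'.
have -> : - (L * pairing (M ^~ t) ('X * P n t) (adjp (P m t))) =
    pairing (fun k => - (L * M k.+1 t)) (P n t) (adjp (P m t)).
  have -> : (fun k => - (L * M k.+1 t)) = (fun k => - L * M k.+1 t).
    by apply/funext => k; rewrite mulNr.
  rewrite pairing_shift -mulNr pairing_momentsMl// => i.
  by apply/commr_sym/commrN/commr_sym; have [] := comm n It.
by apply: (pairing_derive (near_size n) (near_size' m) _ _ (fun k => dM k It) PdP
   (adjp_derive PdP')); rewrite ?size_adjp; exact: leqW.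
Qed.

(** The terms with the derivative of [P n] vanish by orthogonality. *)
Let sqnorm_derive n : mx_is_derive t (sqnorm n) (- (L * (B n t * sqnorm n t))).
Proof.
have [dP sdP PdP] := poly_derivative_lower (der_P n).
have := dpair sdP PdP sdP PdP.
rewrite orthl// orthr ?size_adjp//.
by rewrite sub0r addr0 -normB.
Qed.

(** Differentiate the orthogonality of [P n.+1] and [P n]: the derivative of [P n.+1]
    has degree at most [n], so its pairing with [P n] sees only the coefficient of
    degree [n]. *)
Let subleading_derive n : mx_is_derive t (fun s => (P n.+1 s)`_n) (L * C n.+1 t).
Proof.
have [dP sdP PdP] := poly_derivative_lower (der_P n.+1).
have [dP' sdP' PdP'] := poly_derivative_lower (der_P n).
have := dpair sdP PdP sdP' PdP'.
rewrite pairl// orthr ?size_adjp ?leqW//.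
rewrite addr0 -pairC// mulrA -mulrBl => dz.
have d0 : mx_is_derive t (fun s => pairing (M ^~ s) (P n.+1 s) (adjp (P n s))) 0.
  apply: mx_is_derive_near (mx_is_derive_cst _ 0).
  by apply: nearI => s Is; rewrite orth// gtn_eqF.
have /eqP := mx_is_derive_unique dz d0.
rewrite -[X in _ == X](mul0r (sqnorm n t)) => /eqP/(mulIr (unitH n It))/eqP.
by rewrite subr_eq0 => /eqP <-; exact: PdP.
Qed.

Lemma toda_B n : mx_is_derive t (B n) (L * (C n t - C n.+1 t)).
Proof.
apply: (@mx_is_derive_near _ _ _ _ (fun s =>
  (if n is m.+1 then (P n s)`_m else 0) - (P n.+1 s)`_n)).
  by apply: nearI => s Is; rewrite subleading.
rewrite mulrBr; apply: mx_is_deriveB; last exact: subleading_derive.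
by case: n => [|n]; [rewrite C0// mulr0; exact: mx_is_derive_cst|exact: subleading_derive].
Qed.

(** Differentiate [C n.+1 * sqnorm n = sqnorm n.+1] and cancel [sqnorm n]. *)
Lemma toda_C n :
  mx_is_derive t (C n.+1) (L * (C n.+1 t * B n t - B n.+1 t * C n.+1 t)).
Proof.
have [X CX] := der_C (der_P n) (der_P n.+1).
have dCH := mx_is_derive_mulr CX (sqnorm_derive n).
have dH : mx_is_derive t (fun s => C n.+1 s * sqnorm n s)
    (- (L * (B n.+1 t * sqnorm n.+1 t))).
  apply: mx_is_derive_near (sqnorm_derive n.+1).
  by apply: nearI => s Is; rewrite normC.
have := mx_is_derive_unique dCH dH.
have [_ _ cC] := comm n.+1 It.
rewrite -normC// mulrN !mulrA -mulrBl -[RHS]mulNr => /(mulIr (unitH n It)) /eqP.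
rewrite subr_eq => /eqP E.
suff <- : X = L * (C n.+1 t * B n t - B n.+1 t * C n.+1 t) by [].
by rewrite E addrC mulrBr !mulrA cC.
Qed.

End TodaEquations.

(** * From the matrix weight to its moments *)

Section MatrixInnerProduct.
Variables (R : realType) (N : nat).
Local Notation A := 'M[R[i]]_N.+1.

(** The support is closed: a null open neighbourhood of one point lies in the
    complement. *)
Lemma msupport_measurable (mu : {measure set (measurableTypeR R) -> \bar R}) :
  measurable (msupport mu : set (measurableTypeR R)).
Proof.
apply: measurable_realfun.closed_measurable.
rewrite -[msupport mu]setCK; apply: open_closedC.
rewrite openE => x /= /existsNP[U /not_implyP[oU /not_implyP[Ux muU]]].
by apply: filterS (open_nbhs_nbhs (conj oU Ux)) => y Uy /(_ U oU Uy).
Qed.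

Lemma posdef_unit (H : A) : posdefmx H -> H \is a GRing.unit.
Proof.
move=> [_ pH]; apply: contraT => uH.
have : kermx H != 0 by rewrite kermx_eq0 row_free_unit.
move=> /rowV0Pn[v /sub_kermxP vH v0].
by have := pH v v0; rewrite vH mul0mx mxE ltxx.
Qed.

Lemma evalmxE (p : {poly A}) x :
  evalmx p x = \sum_(i < size p) (x ^+ i)%:C *: p`_i.
Proof.
rewrite /evalmx horner_coef; apply: eq_bigr => i _.
have -> : ((x%:C)%:M : A) ^+ i = ((x ^+ i)%:C)%:M.
  by rewrite -!rmorphXn.
by rewrite -mulmxE mul_mx_scalar.
Qed.

Lemma mx_integral_pairing (mu : {measure set (measurableTypeR R) -> \bar R})
    (D : set R) (W : R -> A) (p q : {poly A}) :
  measurable (D : set (measurableTypeR R)) ->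
  (forall k, mx_integrable mu D (fun x => (x ^+ k)%:C *: W x)) ->
  mx_integral mu D (fun x => evalmx p x *m W x *m (evalmx q x)^t*) =
  pairing (fun k => mx_integral mu D (fun x => (x ^+ k)%:C *: W x)) p (adjp q).
Proof.
move=> mD iW; rewrite /pairing size_adjp.
pose F i j x := p`_i *m ((x ^+ (i + j))%:C *: W x) *m (q`_j)^t*.
have iF i j : mx_integrable mu D (F i j) /\ mx_integral mu D (F i j) =
    p`_i * mx_integral mu D (fun x => (x ^+ (i + j))%:C *: W x) * (adjp q)`_j.
  have [iL eL] := mx_integralMl mD p`_i (iW (i + j)%N).
  have [iR eR] := mx_integralMr mD ((q`_j)^t*) iL.
  by split; rewrite ?coef_adjp -?mulmxE -?eL.
have iS i := mx_integral_sum mD (index_enum 'I_(size q))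
  (fun j : 'I_(size q) => (iF i j).1).
have [_ eS] := mx_integral_sum mD (index_enum 'I_(size p))
  (fun i : 'I_(size p) => (iS i).1).
have -> : (fun x => evalmx p x *m W x *m (evalmx q x)^t*) =
    (fun x => \sum_(i < size p) \sum_(j < size q) F i j x).
  apply/funext => x; rewrite !evalmxE !mulmx_suml; apply: eq_bigr => i _.
  have -> : (\sum_(j < size q) (x ^+ j)%:C *: q`_j)^t* =
      \sum_(j < size q) (x ^+ j)%:C *: (q`_j)^t*.
    rewrite (raddf_sum (@trmx _ _ _)) raddf_sum.
    by apply: eq_bigr => j _; exact: adj_real_scale.
  rewrite mulmx_sumr; apply: eq_bigr => j _; rewrite /F.
  by rewrite -!scalemxAl -!scalemxAr -!scalemxAl scalerA exprD rmorphM mulrC.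
rewrite eS; apply: eq_bigr => i _; rewrite (iS i).2; apply: eq_bigr => j _.
exact: (iF i j).2.
Qed.

End MatrixInnerProduct.

(* The matrix size is N.+1. The hypothesis at the origin is part of
   Lambda W(x;t) = W(x;t) Lambda^*, which positivity of W(x;t) forces for every
   x <> 0 only. *)
Theorem proposition2p2 (R : realType) (N : nat)
    (mu : {measure set (measurableTypeR R) -> \bar R})
    (W : R -> 'M[R[i]]_N.+1) (Lambda : 'M[R[i]]_N.+1) (I : set R)
    (P : nat -> R -> {poly 'M[R[i]]_N.+1})
    (B C : nat -> R -> 'M[R[i]]_N.+1) :
  ~ finite_set (msupport mu) ->
  mx_measurable_fun (msupport mu) W ->
  open I -> is_interval I -> I 0 ->
  (forall x t, msupport mu x -> I t -> posdefmx (toda_weight Lambda W x t)) ->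
  (forall (k : nat) t, I t ->
    mx_integrable mu (msupport mu)
      (fun x => (x ^+ k)%:C *: toda_weight Lambda W x t)) ->
  ((0 < mu [set 0%R])%E -> Lambda *m W 0 = W 0 *m Lambda^t*) ->
  (forall t, I t ->
    monic_orthopoly mu (fun x => toda_weight Lambda W x t) (fun n => P n t)) ->
  (forall t, I t -> C 0%N t = 0) ->
  (forall n t, I t ->
    'X * P n t =
      P n.+1 t + (B n t)%:P * P n t
      + (C n t)%:P * (if n is m.+1 then P m t else 0)) ->
  forall t, I t ->
    (forall n, (1 <= n)%N ->
      mx_is_derive t (C n) (Lambda *m (C n t *m B n.-1 t - B n t *m C n t))) /\
    (forall n,
      mx_is_derive t (B n) (Lambda *m (C n t - C n.+1 t))).
Proof.
move=> _ _ oI _ _ pV iV L0 oP C0 rec t It.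
pose V := toda_weight Lambda W; pose M := moment mu (msupport mu) V.
have mD := msupport_measurable mu.
have dV x s := toda_weight_derive Lambda W x s.
have dM k s : I s -> mx_is_derive s (M k) (- (Lambda * M k.+1 s)).
  by move=> Is; exact: (moment_derive mD oI dV pV iV).
have LM k s : I s -> Lambda * M k s = M k s * Lambda^t*.
  move=> Is; apply: (moment_intertwine mD oI dV pV iV) => // mu0.
  by rewrite !toda_weight0; exact: L0.
have pairE s n m : I s -> pairing (M ^~ s) (P n s) (adjp (P m s)) =
    mx_integral mu (msupport mu)
      (fun x => evalmx (P n s) x *m V x s *m (evalmx (P m s) x)^t*).
  by move=> Is; rewrite mx_integral_pairing// => k; exact: iV.
have sP n s : I s -> size (P n s) = n.+1 by move=> /oP[/(_ n)[]].
have mP n s : I s -> P n s \is monic by move=> /oP[/(_ n)[]].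
have normE n s (H : nat -> 'M[R[i]]_N.+1) : I s ->
   (forall n m, mx_integral mu (msupport mu)
        (fun x => evalmx (P n s) x *m V x s *m (evalmx (P m s) x)^t*) =
      if n == m then H n else 0) -> sqnorm M P n s = H n.
  by move=> Is PH; rewrite /sqnorm pairE// PH eqxx.
have orth n m s : I s -> pairing (M ^~ s) (P n s) (adjp (P m s)) =
    if n == m then sqnorm M P n s else 0.
  by move=> Is; have [_ [H [_ PH]]] := oP s Is; rewrite pairE// PH (normE n s H).
have unitH n s : I s -> sqnorm M P n s \is a GRing.unit.
  by move=> Is; have [_ [H [pH PH]]] := oP s Is; rewrite (normE n s H)//;
    exact: posdef_unit.
split=> [[//|n] _|n].
- exact: (toda_C oI dM LM sP mP orth unitH C0 rec It).
- exact: (toda_B oI dM LM sP mP orth unitH C0 rec It).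
Qed.
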